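(* Let $S$ be a non-empty set. For any commutator identity $w_1\cdots w_m\equiv 1$ in the free group on $S$, there exist an $S$-colored oriented doodle diagram $D$ in $S^2$ and a noose system ${\cal N}$ for $D$ such that $I(D,{\cal N})$ is the given commutator identity.
   Context: We identify $S^2$ with $\mathbb{R}^2\cup\{\infty\}$. A doodle diagram is a finite collection of oriented immersed circles in $S^2$ whose multiple points are transverse double points (crossings). It is $S$-colored if each component is labelled by an element of $S$. ${\rm Word}(S\cup S^{-1})$ is the free monoid on $S$ and formal inverses $S^{-1}$. A commutator identity on $S$ is an expression $w_1\cdots w_m\equiv 1$ with each $w_i\in{\rm Word}(S\cup S^{-1})$ representing an element of the commutator subgroup of the free group on $S$ and $w_1\cdots w_m$ representing the identity. A noose is the image $N$ of an embedding into $S^2$ of $X=D^2\cup I'$, $D^2$ the closed unit disk, $I'=[1,2]\times\{0\}$; head = image of $D^2$, loop = image of $\partial D^2$ (oriented counterclockwise), rope = image of $I'$, neck = image of $(1,0)$, root = image of $(2,0)$. A noose for $D$: root misses $D$, loop and rope transverse to $D$ and missing crossings. A noose system for $D$: a sequence $(N_1,\dots,N_m)$ of nooses for $D$, pairwise disjoint except for a common root (base point), ropes appearing counterclockwise in this order around the base point, every crossing of $D$ lying in some head. For a path $\alpha$ transverse to $D$, the intersection letter at $x\in\alpha\cap D$ is $a^{\epsilon}$, $a$ the label of the component through $x$, $\epsilon=+1$ if $\alpha$ crosses it from its right-hand side to its left-hand side (with respect to its orientation), $-1$ otherwise; the intersection word along $\alpha$ is the product of letters in order. The intersection word of a noose is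 that along the path from the root along the rope, once counterclockwise around the loop, back to the root. $I(D,{\cal N})$ is the expression $w_1\cdots w_m\equiv1$ with $w_i$ the intersection word of $N_i$. *)

(* Defs.v *)
From Stdlib Require Import Reals Lra List Sorted.
From Coquelicot Require Import Coquelicot.
Import ListNotations.
Open Scope R_scope.

Set Implicit Arguments.

(* A letter (a, true) is a, (a, false) is the formal inverse a^{-1}.   *)
Definition word (S : Type) := list (S * bool).

Definition inv_letter {S : Type} (x : S * bool) : S * bool := (fst x, negb (snd x)).
Definition inv_word {S : Type} (w : word S) : word S := rev (map inv_letter w).

Inductive free_eq {S : Type} : word S -> word S -> Prop :=
| fe_cancel : forall (u v : word S) (x : S * bool),
    free_eq (u ++ x :: inv_letter x :: v) (u ++ v)
| fe_refl : forall w, free_eq w w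
| fe_sym : forall w1 w2, free_eq w1 w2 -> free_eq w2 w1
| fe_trans : forall w1 w2 w3, free_eq w1 w2 -> free_eq w2 w3 -> free_eq w1 w3.

Definition commutator {S : Type} (u v : word S) : word S :=
  u ++ v ++ inv_word u ++ inv_word v.

Definition in_commutator_subgroup {S : Type} (w : word S) : Prop :=
  exists l : list (word S * word S),
    free_eq w (concat (map (fun p => commutator (fst p) (snd p)) l)).

Definition commutator_identity {S : Type} (ws : list (word S)) : Prop :=
  List.Forall in_commutator_subgroup ws /\ free_eq (concat ws) [].

Definition pt := (R * R)%type.

Definition det (u v : pt) : R := fst u * snd v - snd u * fst v.

Definition is_dvec (f : R -> pt) (t : R) (v : pt) : Prop :=
  is_derive (fun s => fst (f s)) t (fst v) /\ is_derive (fun s => snd (f s)) t (snd v).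

Definition dvec (f : R -> pt) (t : R) : pt :=
  (Derive (fun s => fst (f s)) t, Derive (fun s => snd (f s)) t).

Record component (S : Type) := Comp { label : S; curve : R -> pt }.

Definition immersed_circle (f : R -> pt) : Prop :=
  (forall t, f (t + 1) = f t) /\
  (forall t, ex_derive (fun s => fst (f s)) t /\ ex_derive (fun s => snd (f s)) t) /\
  (forall t, continuous (fun s => fst (dvec f s)) t /\
             continuous (fun s => snd (dvec f s)) t) /\
  (forall t, dvec f t <> (0, 0)).

Definition preimage {S : Type} (D : list (component S)) (p : pt) (i : nat) (t : R) : Prop :=
  (i < length D)%nat /\ 0 <= t < 1 /\
  exists c, nth_error D i = Some c /\ curve c t = p.

Definition on_diagram {S : Type} (D : list (component S)) (p : pt) : Prop :=
  exists i t, preimage D p i t.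

Definition tangent {S : Type} (D : list (component S)) (i : nat) (t : R) : pt :=
  match nth_error D i with Some c => dvec (curve c) t | None => (0, 0) end.

Definition crossing {S : Type} (D : list (component S)) (p : pt) : Prop :=
  exists i t j u, preimage D p i t /\ preimage D p j u /\ (i, t) <> (j, u).

Definition doodle {S : Type} (D : list (component S)) : Prop :=
  List.Forall (fun c => immersed_circle (curve c)) D /\
  (forall p i1 t1 i2 t2 i3 t3,
      preimage D p i1 t1 -> preimage D p i2 t2 -> preimage D p i3 t3 ->
      (i1, t1) = (i2, t2) \/ (i1, t1) = (i3, t3) \/ (i2, t2) = (i3, t3)) /\
  (forall p i t j u, preimage D p i t -> preimage D p j u -> (i, t) <> (j, u) ->
      det (tangent D i t) (tangent D j u) <> 0).

(* letter at an intersection: a^{+1} iff alpha crosses from the right-hand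
   side to the left-hand side of the component, i.e. det(gamma', alpha') > 0 *)
Definition letter_at {S : Type} (D : list (component S)) (alpha : R -> pt)
  (x : R * nat * R) : option (S * bool) :=
  let '(tau, i, t) := x in
  match nth_error D i with
  | Some c => Some (label c, if Rlt_dec 0 (det (tangent D i t) (dvec alpha tau)) then true else false)
  | None => None
  end.

Definition intersection_word {S : Type} (D : list (component S)) (alpha : R -> pt)
  (a b : R) (w : word S) : Prop :=
  exists l : list (R * nat * R),
    Sorted (fun x y => fst (fst x) < fst (fst y)) l /\
    List.Forall (fun x => let '(tau, i, t) := x in a < tau < b /\ preimage D (alpha tau) i t) l /\
    (forall tau, a <= tau <= b -> on_diagram D (alpha tau) ->
       exists i t, In (tau, i, t) l) /\
    map (letter_at D alpha) l = map Some w.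

(* A noose is given by an embedding of X = D^2 u [1,2]x{0}: head_map is the
   map on the closed unit disk, rope_map t the image of (t,0), t in [1,2]. *)
Record noose := Noose { head_map : pt -> pt; rope_map : R -> pt }.

Definition in_disk (q : pt) : Prop := fst q ^ 2 + snd q ^ 2 <= 1.

Definition head (n : noose) (p : pt) : Prop := exists q, in_disk q /\ head_map n q = p.
Definition on_rope (n : noose) (p : pt) : Prop := exists t, 1 <= t <= 2 /\ rope_map n t = p.
Definition in_noose (n : noose) (p : pt) : Prop := head n p \/ on_rope n p.

Definition loop (n : noose) (th : R) : pt :=
  head_map n (cos (2 * PI * th), sin (2 * PI * th)).
Definition neck (n : noose) : pt := rope_map n 1.
Definition root (n : noose) : pt := rope_map n 2.

Definition leftn (v : pt) : pt := (- snd v, fst v).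

(* n is an embedding of X into the plane; the loop parametrization is
   counterclockwise, i.e. the head lies on the left of the loop. *)
Definition noose_embedding (n : noose) : Prop :=
  (forall q, continuous (head_map n) q) /\
  (forall t, continuous (rope_map n) t) /\
  (forall q1 q2, in_disk q1 -> in_disk q2 -> head_map n q1 = head_map n q2 -> q1 = q2) /\
  (forall t1 t2, 1 <= t1 <= 2 -> 1 <= t2 <= 2 -> rope_map n t1 = rope_map n t2 -> t1 = t2) /\
  rope_map n 1 = head_map n (1, 0) /\
  (forall t q, 1 < t <= 2 -> in_disk q -> rope_map n t <> head_map n q) /\
  (forall th v, is_dvec (loop n) th v -> v <> (0, 0) ->
     exists delta, 0 < delta /\ forall s, 0 < s < delta ->
       head n (fst (loop n th) + s * fst (leftn v), snd (loop n th) + s * snd (leftn v))).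

Definition transverse_at {S : Type} (D : list (component S)) (f : R -> pt) (s : R) : Prop :=
  ~ crossing D (f s) /\
  exists v, is_dvec f s v /\
    forall i t, preimage D (f s) i t -> det (tangent D i t) v <> 0.

Definition noose_for {S : Type} (D : list (component S)) (n : noose) : Prop :=
  noose_embedding n /\
  ~ on_diagram D (root n) /\
  ~ on_diagram D (neck n) /\
  (forall th, on_diagram D (loop n th) -> transverse_at D (loop n) th) /\
  (forall t, 1 <= t <= 2 -> on_diagram D (rope_map n t) -> transverse_at D (rope_map n) t) /\
  (* the rope has a well-defined outgoing direction at the root *)
  (ex_derive (fun s => fst (rope_map n s)) 2 /\ ex_derive (fun s => snd (rope_map n s)) 2 /\
   dvec (rope_map n) 2 <> (0, 0)).

Definition noose_path (n : noose) (tau : R) : pt :=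
  if Rle_dec tau 1 then rope_map n (2 - tau)
  else if Rle_dec tau 2 then loop n (tau - 1)
  else rope_map n (tau - 1).

Definition noose_word {S : Type} (D : list (component S)) (n : noose) (w : word S) : Prop :=
  intersection_word D (noose_path n) 0 3 w.

(* outgoing direction of the rope at the root *)
Definition rope_dir (n : noose) : pt :=
  (- fst (dvec (rope_map n) 2), - snd (dvec (rope_map n) 2)).

Definition noose_system {S : Type} (D : list (component S)) (ns : list noose) : Prop :=
  List.Forall (noose_for D) ns /\
  exists base : pt,
    List.Forall (fun n => root n = base) ns /\
    (forall i j ni nj, i <> j -> nth_error ns i = Some ni -> nth_error ns j = Some nj ->
       forall p, in_noose ni p -> in_noose nj p -> p = base) /\
    (* ropes appear counterclockwise in this order around the base point *)
    (exists (th0 : R) (ang : nat -> R),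
       (forall k n, nth_error ns k = Some n ->
          th0 <= ang k < th0 + 2 * PI /\
          exists rho, 0 < rho /\ rope_dir n = (rho * cos (ang k), rho * sin (ang k))) /\
       (forall k, (k + 1 < length ns)%nat -> ang k < ang (k + 1)%nat)) /\
    (forall p, crossing D p -> exists n, In n ns /\ head n p).

(* Main.v *)
Require Import Defs.
From Stdlib Require Import Reals List Lra Lia Sorted ZArith Arith ClassicalEpsilon.
From Coquelicot Require Import Coquelicot.
Import ListNotations.

(** Put the letters of [w_1 ... w_m], in order, at points of the x-axis. Since the product is
    trivial in the free group, its letters admit a non-crossing matching into mutually
    inverse pairs; join matched points by semicircles in the lower half-plane, which are
    then disjoint. Since each [w_i] has all exponent sums zero, its own letters also admit a
    matching into inverse pairs, possibly crossing; join these by semicircles in the upper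
    half-plane. The semicircles meet the axis orthogonally, hence close up to C^1 curves,
    which run downwards through the positive letters and upwards through the negative
    ones; the curves carry a constant label. If the points are chosen to grow fast enough,
    no three upper semicircles are concurrent. The head of the i-th noose is a tall
    half-ellipse standing on the axis over the letters of [w_i]; it contains all
    crossings of the i-th block, and its loop meets the diagram only on the flat side,
    traversed from left to right, where it reads [w_i]. The ropes are straight segments from
    the tops of the heads, which have equal height, to a common point above them. *)

(** * Matchings and cycles *)

Open Scope nat_scope.

(** The two hypotheses act on opposite sides of the axis. A head stands over one block, so it can
    absorb a crossing only if both arcs belong to that block; membership in the commutator subgroup
    enters only through exponent sums, which give a matching inside each block but no planarity.
    Triviality of the product gives planarity below the axis, where there are no heads, at the price
    of pairs that may join different blocks. The obstacle above the axis is that many semicircles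
    may pass through one point. With integer abscissae a triple point is an arithmetic coincidence
    between six endpoints, which is impossible once the largest of them exceeds a multiple of the
    cube of the others. The geometry is turned into algebra by the equation
    [(x - a) * (b - x) = y ^ 2] of the circle with diameter from [a] to [b]: disjointness, nesting,
    concurrency and containment in a head become comparisons of such products. The closed curves are
    the cycles of a permutation of the sites. *)

Lemma inv_letterK {S : Type} (x : S * bool) : inv_letter (inv_letter x) = x.
Proof. destruct x as [a []]; reflexivity. Qed.

Lemma inv_letter_neq {S : Type} (x : S * bool) : inv_letter x <> x.
Proof. destruct x as [a []]; discriminate. Qed.

Definition letter_eq_dec {S : Type} (x y : S * bool) : {x = y} + {x <> y} :=
  excluded_middle_informative (x = y).

(** Free reduction on a stack: [s] holds the reduced prefix backwards, with the last letter read on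
    top. *)
Definition push {S : Type} (x : S * bool) (s : word S) : word S :=
  match s with
  | y :: s' => if letter_eq_dec y (inv_letter x) then s' else x :: s
  | [] => [x]
  end.

Fixpoint reduced {S : Type} (s : word S) : Prop :=
  match s with
  | x :: ((y :: _) as s') => y <> inv_letter x /\ reduced s'
  | _ => True
  end.

Definition reduce {S : Type} (w s : word S) : word S :=
  fold_left (fun s x => push x s) w s.

Lemma reduced_tail {S : Type} (x : S * bool) s : reduced (x :: s) -> reduced s.
Proof. destruct s; simpl; tauto. Qed.

Lemma push_reduced {S : Type} (x : S * bool) s : reduced s -> reduced (push x s).
Proof.
  destruct s as [|y s]; simpl; [tauto|intros H].
  destruct letter_eq_dec as [e|e].
  - exact (reduced_tail _ _ H).
  - split; assumption.
Qed.

(** The delicate case is a pop by [push x]: restoring the popped letter would cancel once more if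
    [x] lay just below it, which reducedness forbids. *)
Lemma push_cancel {S : Type} (x : S * bool) s :
  reduced s -> push (inv_letter x) (push x s) = s.
Proof.
  intros H. destruct s as [|y s]; simpl.
  - destruct letter_eq_dec as [e|e]; [reflexivity|].
    now rewrite inv_letterK in e.
  - destruct (letter_eq_dec y (inv_letter x)) as [e|e].
    + subst y. destruct s as [|z s]; simpl; [reflexivity|].
      destruct letter_eq_dec as [e|e]; [|reflexivity].
      simpl in H. tauto.
    + simpl. destruct letter_eq_dec as [e'|e']; [reflexivity|].
      now rewrite inv_letterK in e'.
Qed.

Lemma reduce_reduced {S : Type} (w s : word S) : reduced s -> reduced (reduce w s).
Proof.
  revert s; induction w as [|x w IH]; intros s H; simpl; auto using push_reduced.
Qed.

(* [push x] and [push (inv_letter x)] are mutually inverse on reduced words, so that the free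
   group acts on them. *)
Lemma reduce_free_eq {S : Type} (u v : word S) :
  free_eq u v -> forall s, reduced s -> reduce u s = reduce v s.
Proof.
  induction 1 as [u v x| | w1 w2 H IH | w1 w2 w3 H1 IH1 H2 IH2]; intros s Hs.
  - unfold reduce. rewrite !fold_left_app. simpl.
    now rewrite push_cancel by exact (reduce_reduced u s Hs).
  - reflexivity.
  - symmetry; auto.
  - rewrite IH1; auto.
Qed.

(** A derivation is a non-crossing matching in disguise: each inserted pair is adjacent when it is
    inserted. *)
Inductive nested {S : Type} : word S -> Prop :=
| nested_nil : nested []
| nested_insert : forall u v x,
    nested (u ++ v) -> nested (u ++ x :: inv_letter x :: v).

(** The word [rev s ++ w] is the surviving prefix followed by the unread rest. Stacking a letter
    leaves it unchanged, and a pop read backwards is the insertion of an inverse pair at the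
    boundary. *)
Lemma reduce_nil_nested {S : Type} (w s : word S) :
  reduce w s = [] -> nested (rev s ++ w).
Proof.
  revert s; induction w as [|x w IH]; intros s; simpl.
  - intros ->. constructor.
  - intros H. apply IH in H. destruct s as [|y s]; simpl in *; [exact H|].
    destruct letter_eq_dec as [e|e].
    + subst y. rewrite <- app_assoc; simpl.
      rewrite <- (inv_letterK x) at 2. now constructor.
    + simpl in H. now rewrite <- !app_assoc in *.
Qed.

Lemma free_eq_nil_nested {S : Type} (w : word S) : free_eq w [] -> nested w.
Proof.
  intros H. apply (reduce_nil_nested w []).
  exact (reduce_free_eq _ _ H [] I).
Qed.

Definition matching {S : Type} (lett : nat -> S * bool) (K : list nat) (f : nat -> nat) : Prop :=
  forall k, In k K -> In (f k) K /\ f (f k) = k /\ lett (f k) = inv_letter (lett k).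

(** One order pattern suffices for a matching: of two interleaved pairs, take [k] and [l] to be the
    two smaller ends. *)
Definition noncrossing (K : list nat) (f : nat -> nat) : Prop :=
  forall k l, In k K -> In l K -> ~ (k < l /\ l < f k /\ f k < f l).

Definition swap (p q : nat) (f : nat -> nat) (k : nat) : nat :=
  if k =? p then q else if k =? q then p else f k.

Ltac swap_cases := unfold swap in *;
  repeat match goal with
  | |- context [?a =? ?b] => destruct (Nat.eqb_spec a b)
  | H : context [?a =? ?b] |- _ => destruct (Nat.eqb_spec a b)
  end.

Lemma swap_matching {S : Type} (lett : nat -> S * bool) K L p q f :
  matching lett L f -> p <> q -> ~ In p L -> ~ In q L ->
  lett q = inv_letter (lett p) ->
  (forall k, In k K <-> k = p \/ k = q \/ In k L) ->
  matching lett K (swap p q f).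
Proof.
  intros M pq pL qL E HK k Hk.
  apply HK in Hk. rewrite HK.
  destruct (Nat.eq_dec k p) as [->|kp].
  - unfold swap at 1 3 4. rewrite Nat.eqb_refl. swap_cases; try congruence. auto.
  - destruct (Nat.eq_dec k q) as [->|kq].
    + assert (swap p q f q = p) as -> by (swap_cases; congruence).
      assert (swap p q f p = q) as -> by (swap_cases; congruence).
      rewrite E, inv_letterK. auto.
    + destruct Hk as [?|[?|Hk]]; [tauto|tauto|].
      destruct (M k Hk) as (H1 & H2 & H3).
      assert (swap p q f k = f k) as -> by (swap_cases; congruence).
      assert (swap p q f (f k) = f (f k)) as -> by (swap_cases; congruence).
      auto.
Qed.

(** The innermost pair occupies neighbours [p], [q] of [K], and every other site lies below [p] or
    above [q], so pairing them crosses nothing. Arbitrary sorted [K] is allowed because the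
    induction removes sites from the middle. *)
Lemma nested_matching {S : Type} (lett : nat -> S * bool) w : nested w ->
  forall K, StronglySorted lt K -> map lett K = w ->
  exists f, matching lett K f /\ noncrossing K f.
Proof.
  induction 1 as [|u v x H IH]; intros K sK eK.
  - apply map_eq_nil in eK. subst K. exists (fun k => k).
    split; intros k; simpl; tauto.
  - apply map_eq_app in eK as (K1 & K2 & -> & e1 & e2).
    destruct K2 as [|p [|q K2]]; try discriminate.
    injection e2 as ep eq e2.
    assert (sK' : StronglySorted lt (K1 ++ K2) /\
      (forall k, In k K1 -> k < p) /\ (forall k, In k K2 -> q < k) /\ p < q).
    { clear - sK. induction K1 as [|k K1 IH]; simpl in *.
      - inversion_clear sK as [|? ? s1 f1]. inversion_clear s1 as [|? ? s2 f2].
        rewrite Forall_forall in f1, f2. simpl in f1.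
        repeat split; auto. tauto.
      - inversion_clear sK as [|? ? s1 f1].
        destruct (IH s1) as (I1 & I2 & I3 & I4).
        rewrite Forall_forall in f1. repeat split; auto.
        + constructor; auto. apply Forall_forall. intros a Ha. apply f1.
          rewrite in_app_iff in *. simpl. tauto.
        + intros a [<-|Ha]; auto. apply f1. rewrite in_app_iff; simpl; tauto. }
    destruct sK' as (sK' & lo & hi & pq).
    destruct (IH (K1 ++ K2) sK') as (f & Mf & Nf).
    { now rewrite map_app, e1, e2. }
    assert (pL : ~ In p (K1 ++ K2)).
    { rewrite in_app_iff. intros [a|a]; [apply lo in a|apply hi in a]; lia. }
    assert (qL : ~ In q (K1 ++ K2)).
    { rewrite in_app_iff. intros [a|a]; [apply lo in a|apply hi in a]; lia. }
    assert (out : forall k, In k (K1 ++ K2) -> k < p \/ q < k).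
    { intros k. rewrite in_app_iff. intros [a|a]; auto. }
    assert (HK : forall k, In k (K1 ++ p :: q :: K2) <-> k = p \/ k = q \/ In k (K1 ++ K2)).
    { intros k. rewrite !in_app_iff. simpl. intuition auto. }
    exists (swap p q f). split.
    + apply swap_matching with (K1 ++ K2); auto; [lia|congruence].
    + intros k l Hk Hl. apply HK in Hk, Hl.
      assert (Of : forall k, In k (K1 ++ K2) -> f k < p \/ q < f k).
      { intros a Ha. apply out. now apply Mf. }
      destruct Hk as [->|[->|Hk]], Hl as [->|[->|Hl]];
      try (pose proof (out _ Hk)); try (pose proof (out _ Hl));
      try (pose proof (Of _ Hk)); try (pose proof (Of _ Hl)); 
      try (pose proof (Nf _ _ Hk Hl));
      swap_cases; lia.
Qed.

(** * Exponent sums and matchings without planarity *)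

Definition sign (b : bool) : Z := if b then 1%Z else (-1)%Z.

(** The homomorphism to the integers that sends a generator [a] to [h a]. Letting [h] vary records
    the image in the abelianization. *)
Fixpoint exponent_sum {S : Type} (h : S -> Z) (w : word S) : Z :=
  match w with
  | [] => 0%Z
  | (a, b) :: w => (sign b * h a + exponent_sum h w)%Z
  end.

Lemma exponent_sum_app {S : Type} (h : S -> Z) (u v : word S) :
  exponent_sum h (u ++ v) = (exponent_sum h u + exponent_sum h v)%Z.
Proof. induction u as [|[a b] u IH]; simpl; lia. Qed.

Lemma exponent_sum_inv {S : Type} (h : S -> Z) (w : word S) :
  exponent_sum h (inv_word w) = (- exponent_sum h w)%Z.
Proof.
  induction w as [|[a b] w IH]; [reflexivity|].
  unfold inv_word in *. cbn -[Z.mul Z.add]. rewrite exponent_sum_app, IH.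
  destruct b; cbn -[Z.mul Z.add]; lia.
Qed.

Lemma exponent_sum_free_eq {S : Type} (h : S -> Z) (u v : word S) :
  free_eq u v -> exponent_sum h u = exponent_sum h v.
Proof.
  induction 1 as [u v [a b]| | |]; try congruence.
  rewrite !exponent_sum_app. destruct b; cbn -[Z.mul Z.add]; lia.
Qed.

Lemma exponent_sum_commutator {S : Type} (h : S -> Z) (w : word S) :
  in_commutator_subgroup w -> exponent_sum h w = 0%Z.
Proof.
  intros [l Hl]. rewrite (exponent_sum_free_eq h _ _ Hl). clear Hl.
  induction l as [|[u v] l IH]; simpl; [reflexivity|].
  unfold commutator at 1. rewrite !exponent_sum_app, !exponent_sum_inv, IH. lia.
Qed.

(** Take for [h] the indicator of the generator of [x]. If the inverse of [x] were missing from [w],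
    every occurrence of that generator would have the sign of [x] and the sum could not vanish. *)
Lemma exists_inverse_letter {S : Type} (x : S * bool) (w : word S) :
  (forall h, exponent_sum h (x :: w) = 0%Z) -> In (inv_letter x) w.
Proof.
  intros H. destruct x as [a b].
  destruct (excluded_middle_informative (In (inv_letter (a, b)) w)) as [|N]; [assumption|].
  exfalso.
  pose (h := fun c => if excluded_middle_informative (c = a) then 1%Z else 0%Z).
  assert (G : (0 <= sign b * exponent_sum h w)%Z).
  { clear H. induction w as [|[c d] w IH]; cbn -[Z.mul Z.add] in *; [lia|].
    assert (0 <= sign b * (sign d * h c))%Z.
    { unfold h. destruct excluded_middle_informative as [e|e]; [subst c|lia].
      destruct b, d; cbn -[Z.mul Z.add]; try lia; exfalso; apply N; left; reflexivity. }
    assert (0 <= sign b * exponent_sum h w)%Z by (apply IH; tauto). lia. }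
  specialize (H h). cbn -[Z.mul Z.add] in H. unfold h at 1 in H.
  destruct excluded_middle_informative; [|congruence].
  destruct b; cbn -[Z.mul Z.add] in *; lia.
Qed.

(** The first letter is paired with any inverse occurrence; the pair contributes nothing to any
    exponent sum, so the rest stays balanced. *)
Lemma balanced_matching {S : Type} (lett : nat -> S * bool) (K : list nat) :
  NoDup K -> (forall h, exponent_sum h (map lett K) = 0%Z) ->
  exists f, matching lett K f.
Proof.
  remember (length K) as n eqn:En. revert K En.
  induction n as [n IH] using (well_founded_induction lt_wf); intros K En ND H.
  destruct K as [|p K].
  { exists (fun k => k). intros k []. }
  pose proof (exists_inverse_letter _ _ H) as I.
  apply in_map_iff in I as (q & eq & Iq).
  apply in_split in Iq as (K1 & K2 & ->).
  inversion_clear ND as [|? ? pN ND'].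
  pose proof (NoDup_remove_1 _ _ _ ND') as ND1.
  pose proof (NoDup_remove_2 _ _ _ ND') as qN.
  destruct (IH (length (K1 ++ K2))) with (K := K1 ++ K2) as [f Mf]; auto.
  - subst n. simpl. rewrite !length_app. simpl. lia.
  - intros h. specialize (H h). rewrite <- H. simpl. rewrite !map_app. simpl.
    rewrite !exponent_sum_app. simpl. rewrite eq.
    destruct (lett p) as [a []]; cbn -[Z.mul Z.add]; lia.
  - exists (swap p q f). apply swap_matching with (K1 ++ K2); auto.
    + intros ->. apply pN. rewrite in_app_iff. simpl. tauto.
    + intros I. apply pN. rewrite in_app_iff in *. simpl. tauto.
    + intros k. simpl. rewrite !in_app_iff. simpl. intuition auto.
Qed.

(** Two of the first [length A + 1] iterates coincide by the pigeonhole principle, and injectivity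
    moves the coincidence back to [r]. The period is then taken minimal, which makes the iterates
    below it distinct. *)
Lemma iter_period (tau : nat -> nat) (A : list nat) :
  (forall a, In a A -> In (tau a) A) ->
  (forall a b, In a A -> In b A -> tau a = tau b -> a = b) ->
  forall r, In r A -> exists p, 0 < p /\ Nat.iter p tau r = r /\
  (forall i j, i < p -> j < p -> Nat.iter i tau r = Nat.iter j tau r -> i = j).
Proof.
  intros cl inj r Hr.
  assert (clI : forall j, In (Nat.iter j tau r) A).
  { induction j; simpl; auto. }
  assert (back : forall i d, Nat.iter i tau r = Nat.iter (i + d) tau r ->
                 Nat.iter d tau r = r).
  { induction i as [|i IH]; simpl; intros d E; [auto|].
    apply IH. apply inj; auto. }
  assert (ex : exists p, 0 < p /\ Nat.iter p tau r = r).
  { apply NNPP. intros N.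
    assert (ND : NoDup (map (fun j => Nat.iter j tau r) (seq 0 (S (length A))))).
    { apply NoDup_map_NoDup_ForallPairs; [|apply seq_NoDup].
      intros i j _ _ E.
      destruct (Nat.lt_trichotomy i j) as [L|[L|L]]; [|assumption|]; exfalso; apply N.
      - exists (j - i). split; [lia|]. apply (back i). rewrite E. f_equal. lia.
      - exists (i - j). split; [lia|]. apply (back j). rewrite <- E. f_equal. lia. }
    apply NoDup_incl_length with (l' := A) in ND.
    - rewrite length_map, length_seq in ND. lia.
    - intros a Ha. apply in_map_iff in Ha as (j & <- & _). apply clI. }
  destruct ex as [p0 Hp0].
  revert Hp0. induction p0 as [p IH] using (well_founded_induction lt_wf).
  intros [p0 Ep].
  destruct (classic (exists d, d < p /\ 0 < d /\ Nat.iter d tau r = r)) as [(d & L & Hd)|N].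
  - exact (IH d L Hd).
  - exists p. repeat split; auto. intros i j Hi Hj E.
    destruct (Nat.lt_trichotomy i j) as [L|[L|L]]; [|assumption|]; exfalso; apply N.
    + exists (j - i). repeat split; try lia. apply (back i). rewrite E. f_equal. lia.
    + exists (i - j). repeat split; try lia. apply (back j). rewrite <- E. f_equal. lia.
Qed.

(** A pair [(r, p)] encodes the cycle of length [p] through [r]. The last clause expresses at once
    that cycles are disjoint and that [p] is the exact period. *)
Definition cycle_decomposition (tau : nat -> nat) (A : list nat) (R : list (nat * nat)) : Prop :=
  (forall i r p, nth_error R i = Some (r, p) ->
     0 < p /\ Nat.iter p tau r = r /\ In r A) /\
  (forall a, In a A -> exists i r p j,
     nth_error R i = Some (r, p) /\ j < p /\ Nat.iter j tau r = a) /\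
  (forall i r p j i' r' p' j',
     nth_error R i = Some (r, p) -> nth_error R i' = Some (r', p') -> j < p -> j' < p' ->
     Nat.iter j tau r = Nat.iter j' tau r' -> i = i' /\ j = j').

(** Split off the orbit [O] of one element and recurse on the complement [B]. By injectivity a
    predecessor of an orbit point lies in the orbit, so [B] is stable under [tau]. *)
Lemma cycle_decomposition_exists (tau : nat -> nat) (A : list nat) :
  (forall a, In a A -> In (tau a) A) ->
  (forall a b, In a A -> In b A -> tau a = tau b -> a = b) ->
  exists R, cycle_decomposition tau A R.
Proof.
  remember (length A) as n eqn:En. revert A En.
  induction n as [n IH] using (well_founded_induction lt_wf); intros A En cl inj.
  destruct A as [|r A'].
  { exists []. repeat split; try (destruct i; discriminate). intros a []. }
  set (A := r :: A') in *.
  assert (Hr : In r A) by (left; reflexivity).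
  destruct (iter_period tau A cl inj r Hr) as (p & p0 & Ep & Ip).
  assert (clI : forall s j, In s A -> In (Nat.iter j tau s) A).
  { intros s j Hs. induction j; [exact Hs|]. apply cl. exact IHj. }
  set (O := map (fun j => Nat.iter j tau r) (seq 0 p)).
  assert (HO : forall a, In a O <-> exists j, j < p /\ Nat.iter j tau r = a).
  { intros a. unfold O. rewrite in_map_iff. split; intros (j & H1 & H2); exists j.
    - rewrite in_seq in H2. split; [lia|assumption].
    - rewrite in_seq. split; [assumption|lia]. }
  set (B := filter (fun a => if in_dec Nat.eq_dec a O then false else true) A).
  assert (HB : forall a, In a B <-> In a A /\ ~ In a O).
  { intros a. unfold B. rewrite filter_In.
    destruct in_dec; split; intros [? ?]; split; auto; try discriminate; tauto. }
  assert (rO : In r O) by (apply HO; exists 0; auto).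
  destruct (IH (length B)) with (A := B) as (R & R1 & R2 & R3); auto.
  - rewrite En. unfold B, A. simpl. destruct in_dec as [_|]; [|tauto].
    apply Nat.lt_succ_r. apply filter_length_le.
  - intros a. rewrite !HB. intros [Ha Na]. split; auto. intros I. apply Na.
    apply HO in I as (j & jp & Ej). apply HO. destruct j as [|j].
    + exists (p - 1). split; [lia|]. apply inj; auto.
      change (tau (Nat.iter (p - 1) tau r)) with (Nat.iter (S (p - 1)) tau r).
      replace (S (p - 1)) with p by lia. simpl in Ej. congruence.
    + exists j. split; [lia|]. apply inj; auto.
  - intros a b. rewrite !HB. intros [Ha _] [Hb _]. auto.
  - assert (clB : forall i s q j, nth_error R i = Some (s, q) -> j < q ->
                    ~ In (Nat.iter j tau s) O).
    { intros i s q j E jq I. apply HO in I as (k & kp & Ek).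
      destruct (R1 _ _ _ E) as (q0 & Eq & Is). apply HB in Is as [Is Ns]. apply Ns.
      apply HO.
      (* A cycle that entered [O] would never leave it, yet after [q - j] more steps it is back at
         its root, which lies in [B]. *)
      assert (G : forall m, exists k', k' < p /\ Nat.iter k' tau r = Nat.iter (m + j) tau s).
      { induction m as [|m (k' & L & E')]; simpl; [eauto|].
        rewrite <- E'. destruct (Nat.eq_dec (S k') p) as [e|e].
        - exists 0. split; [lia|]. simpl. rewrite <- Ep at 1. rewrite <- e. reflexivity.
        - exists (S k'). split; [lia|reflexivity]. }
      destruct (G (q - j)) as (k' & L & E'). exists k'. split; auto. rewrite E'.
      replace (q - j + j) with q by lia. assumption. }
    exists ((r, p) :: R). split; [|split].
    + intros [|i] s q E; [injection E as <- <-; auto|].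
      apply R1 in E as (q0 & Eq & Is). apply HB in Is. tauto.
    + intros a Ha. destruct (in_dec Nat.eq_dec a O) as [I|I].
      * apply HO in I as (j & L & E). exists 0, r, p, j. auto.
      * destruct (R2 a) as (i & s & q & j & H); [apply HB; auto|].
        exists (S i), s, q, j. exact H.
    + intros [|i] s q j [|i'] s' q' j' E E' L L' Ej; simpl in E, E'.
      * injection E as <- <-. injection E' as <- <-. auto.
      * exfalso. injection E as <- <-.
        apply (clB _ _ _ _ E' L'). rewrite <- Ej. apply HO. eauto.
      * exfalso. injection E' as <- <-.
        apply (clB _ _ _ _ E L). rewrite Ej. apply HO. eauto.
      * destruct (R3 _ _ _ _ _ _ _ _ E E' L L' Ej) as [-> ->]. auto.
Qed.

(** * Closed curves made of semicircles *)

Open Scope R_scope.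

(** The choice between [g] and [h] is made point by point, so joints of curves are treated without
    one-sided derivatives. *)
Lemma paste_derive (f g h : R -> R) s d :
  is_derive g s d -> is_derive h s d -> g s = h s ->
  locally s (fun y => f y = g y \/ f y = h y) -> is_derive f s d.
Proof.
  intros Hg Hh E [e He]. apply is_derive_Reals in Hg, Hh. apply is_derive_Reals.
  assert (fs : f s = g s) by (destruct (He s (ball_center s e)); congruence).
  intros eps Heps.
  destruct (Hg eps Heps) as [d1 H1], (Hh eps Heps) as [d2 H2].
  assert (m : 0 < Rmin e (Rmin d1 d2)).
  { repeat apply Rmin_pos; apply cond_pos. }
  exists (mkposreal _ m). intros k k0 Hk. simpl in Hk.
  pose proof (Rmin_l e (Rmin d1 d2)). pose proof (Rmin_r e (Rmin d1 d2)).
  pose proof (Rmin_l d1 d2). pose proof (Rmin_r d1 d2).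
  destruct (He (s + k)) as [-> | ->]; rewrite ?fs.
  - unfold ball; simpl. unfold AbsRing_ball, abs, minus, plus, opp; simpl.
    replace (s + k + - s) with k by ring. lra.
  - apply H1; auto; lra.
  - rewrite E. apply H2; auto; lra.
Qed.

Lemma paste_continuous (f g h : R -> R) s :
  continuous g s -> continuous h s -> g s = h s ->
  locally s (fun y => f y = g y \/ f y = h y) -> continuous f s.
Proof.
  intros Hg Hh E He. apply filterlim_locally. intros eps.
  assert (fs : f s = g s) by (destruct (locally_singleton _ _ He); congruence).
  assert (Lg := proj1 (filterlim_locally _ _) Hg eps).
  assert (Lh := proj1 (filterlim_locally _ _) Hh eps).
  generalize (filter_and _ _ He (filter_and _ _ Lg Lh)).
  apply filter_imp. intros y [[-> | ->] [B1 B2]]; rewrite fs; [|rewrite E]; assumption.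
Qed.

Definition glue (g : Z -> R -> R) (s : R) : R := g (Int_part s) (s - IZR (Int_part s)).

Lemma Int_part_bounds s : IZR (Int_part s) <= s < IZR (Int_part s) + 1.
Proof. destruct (base_Int_part s). lra. Qed.

Lemma Int_part_unique z s : IZR z <= s < IZR z + 1 -> Int_part s = z.
Proof.
  intros H. pose proof (Int_part_bounds s).
  assert (IZR z < IZR (Int_part s + 1)) by (rewrite plus_IZR; lra).
  assert (IZR (Int_part s) < IZR (z + 1)) by (rewrite plus_IZR; lra).
  apply lt_IZR in H1, H2. lia.
Qed.

(** Only at an integer are two pieces involved, the one starting there and its predecessor;
    elsewhere [w = z] makes the two alternatives equal. *)
Lemma glue_local (g : Z -> R -> R) s :
  (forall z, g z 1 = g (z + 1)%Z 0) ->
  exists z w, z = Int_part s /\ (w = z \/ (w = (z - 1)%Z /\ s = IZR z)) /\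
  locally s (fun y => glue g y = g z (y - IZR z) \/ glue g y = g w (y - IZR w)).
Proof.
  intros G. set (z := Int_part s). destruct (Int_part_bounds s) as [H1 H2]. fold z in H1, H2.
  destruct (Rle_lt_or_eq_dec _ _ H1) as [L|Es].
  - exists z, z. split; [reflexivity|]. split; [now left|].
    assert (m : 0 < Rmin (s - IZR z) (IZR z + 1 - s)) by (apply Rmin_pos; lra).
    exists (mkposreal _ m). intros y Hy. left. unfold glue.
    unfold ball in Hy; simpl in Hy. unfold AbsRing_ball, abs, minus, plus, opp in Hy; simpl in Hy.
    pose proof (Rmin_l (s - IZR z) (IZR z + 1 - s)).
    pose proof (Rmin_r (s - IZR z) (IZR z + 1 - s)).
    apply Rabs_def2 in Hy. rewrite (Int_part_unique z y) by lra. reflexivity.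
  - exists z, (z - 1)%Z. split; [reflexivity|]. split; [right; auto|].
    exists (mkposreal _ Rlt_0_1). intros y Hy. unfold glue.
    unfold ball in Hy; simpl in Hy. unfold AbsRing_ball, abs, minus, plus, opp in Hy; simpl in Hy.
    apply Rabs_def2 in Hy. destruct (Rle_lt_dec s y).
    + left. rewrite (Int_part_unique z y) by lra. reflexivity.
    + right. rewrite (Int_part_unique (z - 1)%Z y); [reflexivity|].
      rewrite minus_IZR. lra.
Qed.

Lemma glue_continuous (g : Z -> R -> R) s :
  (forall z, g z 1 = g (z + 1)%Z 0) -> (forall z u, continuous (g z) u) ->
  continuous (glue g) s.
Proof.
  intros G C. destruct (glue_local g s G) as (z & w & -> & Hw & L).
  assert (C' : forall z u, continuous (fun y => g z (y - IZR z)) u).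
  { intros z u. apply (continuous_comp (fun y => y - IZR z) (g z)); [|apply C].
    apply (continuous_minus (fun y => y) (fun _ => IZR z));
      [apply continuous_id|apply continuous_const]. }
  eapply paste_continuous; [apply C'|apply C'| |exact L].
  destruct Hw as [->|[-> E]]; [reflexivity|]. rewrite <- E, minus_IZR, <- E.
  replace (s - s) with 0 by ring. replace (s - (s - 1)) with 1 by ring.
  rewrite G. do 2 f_equal. lia.
Qed.

Lemma glue_derive (g g' : Z -> R -> R) s :
  (forall z, g z 1 = g (z + 1)%Z 0) -> (forall z, g' z 1 = g' (z + 1)%Z 0) ->
  (forall z u, is_derive (g z) u (g' z u)) ->
  is_derive (glue g) s (glue g' s).
Proof.
  intros G G' C. destruct (glue_local g s G) as (z & w & Ez & Hw & L).
  assert (C' : forall z u, is_derive (fun y => g z (y - IZR z)) u (g' z (u - IZR z))).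
  { intros a u. evar_last.
    - apply (is_derive_comp (g a) (fun y => y - IZR a)); [apply C|].
      apply (is_derive_minus (fun y => y) (fun _ => IZR a));
      [apply is_derive_id|apply @is_derive_const].
    - unfold scal, minus, plus, opp, zero, one; simpl. unfold mult; simpl. ring. }
  unfold glue at 2. rewrite <- Ez.
  eapply paste_derive; [apply C'| | |exact L].
  - destruct Hw as [->|[-> E]]; [apply C'|]. evar_last; [apply C'|].
    rewrite E, minus_IZR.
    replace (IZR z - IZR z) with 0 by ring. replace (IZR z - (IZR z - 1)) with 1 by ring.
    rewrite G'. f_equal. lia.
  - destruct Hw as [->|[-> E]]; [reflexivity|]. rewrite E, minus_IZR.
    replace (IZR z - IZR z) with 0 by ring. replace (IZR z - (IZR z - 1)) with 1 by ring.
    rewrite G. do 2 f_equal. lia.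
Qed.

(* The angle is reparametrized so that a semicircle of any radius [r >= 1/2] is
   left and reached with unit speed; this makes consecutive arcs fit together C^1. *)
Definition phi (r u : R) : R := PI * u + (/ r - PI) * (u - 3 * u ^ 2 + 2 * u ^ 3).
Definition dphi (r u : R) : R := PI + (/ r - PI) * (1 - 6 * u + 6 * u ^ 2).

Lemma phi_0 r : phi r 0 = 0.
Proof. unfold phi. ring. Qed.
Lemma phi_1 r : phi r 1 = PI.
Proof. unfold phi. ring. Qed.
Lemma dphi_0 r : dphi r 0 = / r.
Proof. unfold dphi. ring. Qed.
Lemma dphi_1 r : dphi r 1 = / r.
Proof. unfold dphi. ring. Qed.

Lemma inv_radius r : 1 / 2 <= r -> 0 < / r <= 2.
Proof.
  intros H. split; [apply Rinv_0_lt_compat; lra|].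
  rewrite <- (Rinv_inv 2). apply Rinv_le_contravar; lra.
Qed.

Lemma PI_gt_2 : 2 < PI.
Proof. pose proof PI2_1. lra. Qed.

(** The derivative equals [/ r + 6 * (PI - / r) * (u * (1 - u))], and [1 / 2 <= r] gives
    [/ r <= 2 < PI]. *)
Lemma dphi_pos r u : 1 / 2 <= r -> 0 <= u <= 1 -> 0 < dphi r u.
Proof.
  intros Hr Hu. apply inv_radius in Hr. pose proof PI_gt_2. unfold dphi.
  assert (0 <= u * (1 - u)) by (apply Rmult_le_pos; lra).
  assert (0 <= (PI - / r) * (u * (1 - u))) by (apply Rmult_le_pos; lra). lra.
Qed.

Lemma phi_increasing r u v : 1 / 2 <= r -> 0 <= u -> u < v -> v <= 1 -> phi r u < phi r v.
Proof.
  intros Hr Hu Huv Hv. apply inv_radius in Hr. pose proof PI_gt_2. unfold phi.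
  (* The difference quotient of [phi r] between [u] and [v] is [/ r + (PI - / r) * q]. *)
  set (q := 3 * (u + v) - 2 * (u ^ 2 + u * v + v ^ 2)).
  assert (0 <= q).
  { unfold q. assert (0 <= u * (1 - u)) by (apply Rmult_le_pos; lra).
    assert (0 <= v * (1 - v)) by (apply Rmult_le_pos; lra).
    pose proof (pow2_ge_0 (u - v)). lra. }
  assert (0 <= (PI - / r) * q) by (apply Rmult_le_pos; lra).
  assert (0 < (v - u) * (/ r + (PI - / r) * q)) by (apply Rmult_lt_0_compat; lra).
  unfold q in *. lra.
Qed.

Lemma phi_range r u : 1 / 2 <= r -> 0 < u < 1 -> 0 < phi r u < PI.
Proof.
  intros Hr Hu. rewrite <- (phi_0 r) at 1. rewrite <- (phi_1 r).
  split; apply phi_increasing; lra.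
Qed.

(** The signed half-width [(b - a) / 2] makes the arc run from [a] to [b] whichever is larger; in
    [arcy] the sign [e] selects the half-plane. *)
Definition arcx (a b u : R) : R := (a + b) / 2 - (b - a) / 2 * cos (phi (Rabs (b - a) / 2) u).
Definition arcy (a b e u : R) : R := e * (Rabs (b - a) / 2) * sin (phi (Rabs (b - a) / 2) u).
Definition darcx (a b u : R) : R :=
  (b - a) / 2 * sin (phi (Rabs (b - a) / 2) u) * dphi (Rabs (b - a) / 2) u.
Definition darcy (a b e u : R) : R :=
  e * (Rabs (b - a) / 2) * cos (phi (Rabs (b - a) / 2) u) * dphi (Rabs (b - a) / 2) u.

Lemma phi_derive r u : is_derive (phi r) u (dphi r u).
Proof. unfold phi, dphi. auto_derive; [trivial|]. ring. Qed.

Lemma arcx_derive a b u : is_derive (arcx a b) u (darcx a b u).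
Proof.
  unfold arcx, darcx. pose proof (phi_derive (Rabs (b - a) / 2) u) as H.
  auto_derive; [now exists (dphi (Rabs (b - a) / 2) u)|].
  replace (Derive _ u) with (dphi (Rabs (b - a) / 2) u)
    by (symmetry; exact (is_derive_unique _ _ _ H)).
  field.
Qed.

Lemma arcy_derive a b e u : is_derive (arcy a b e) u (darcy a b e u).
Proof.
  unfold arcy, darcy. pose proof (phi_derive (Rabs (b - a) / 2) u) as H.
  auto_derive; [now exists (dphi (Rabs (b - a) / 2) u)|].
  replace (Derive _ u) with (dphi (Rabs (b - a) / 2) u)
    by (symmetry; exact (is_derive_unique _ _ _ H)).
  field.
Qed.

Lemma darcx_continuous a b u : continuous (darcx a b) u.
Proof.
  apply (ex_derive_continuous (darcx a b)). unfold darcx, phi, dphi. now auto_derive.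
Qed.

Lemma darcy_continuous a b e u : continuous (darcy a b e) u.
Proof.
  apply (ex_derive_continuous (darcy a b e)). unfold darcy, phi, dphi. now auto_derive.
Qed.

Lemma arcx_0 a b : arcx a b 0 = a.
Proof. unfold arcx. rewrite phi_0, cos_0. field. Qed.
Lemma arcx_1 a b : arcx a b 1 = b.
Proof. unfold arcx. rewrite phi_1, cos_PI. field. Qed.
Lemma arcy_0 a b e : arcy a b e 0 = 0.
Proof. unfold arcy. rewrite phi_0, sin_0. ring. Qed.
Lemma arcy_1 a b e : arcy a b e 1 = 0.
Proof. unfold arcy. rewrite phi_1, sin_PI. ring. Qed.
Lemma darcx_0 a b : darcx a b 0 = 0.
Proof. unfold darcx. rewrite phi_0, sin_0. ring. Qed.
Lemma darcx_1 a b : darcx a b 1 = 0.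
Proof. unfold darcx. rewrite phi_1, sin_PI. ring. Qed.
(** An arc leaves the axis with vertical velocity [e] and returns with velocity [- e], so successive
    arcs fit exactly when their signs alternate. *)
Lemma darcy_0 a b e : 1 <= Rabs (b - a) -> darcy a b e 0 = e.
Proof. intros H. unfold darcy. rewrite phi_0, cos_0, dphi_0. field. lra. Qed.
Lemma darcy_1 a b e : 1 <= Rabs (b - a) -> darcy a b e 1 = - e.
Proof. intros H. unfold darcy. rewrite phi_1, cos_PI, dphi_1. field. lra. Qed.

Lemma sqr_abs_half x : (Rabs x / 2) * (Rabs x / 2) = x / 2 * (x / 2).
Proof. pose proof (Rsqr_abs x) as H. unfold Rsqr in H. lra. Qed.

(** Thales: the height over a point of the diameter is the geometric mean of the two segments. The
    equation is symmetric in [a], [b] and blind to [e]. *)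
Lemma arc_circle a b e u : e * e = 1 ->
  (arcx a b u - a) * (b - arcx a b u) = arcy a b e u * arcy a b e u.
Proof.
  intros He. unfold arcx, arcy. set (f := phi (Rabs (b - a) / 2) u).
  pose proof (sin2_cos2 f) as H. unfold Rsqr in H. pose proof (sqr_abs_half (b - a)) as E.
  transitivity ((b - a) / 2 * ((b - a) / 2) * (1 - cos f * cos f)); [field|].
  replace (1 - cos f * cos f) with (sin f * sin f) by lra.
  rewrite <- E.
  replace (e * (Rabs (b - a) / 2) * sin f * (e * (Rabs (b - a) / 2) * sin f))
    with ((e * e) * (Rabs (b - a) / 2 * (Rabs (b - a) / 2) * (sin f * sin f))) by ring.
  rewrite He. ring.
Qed.

Lemma arcy_pos a b u : 1 <= Rabs (b - a) -> 0 < u < 1 -> 0 < arcy a b 1 u.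
Proof.
  intros H Hu. unfold arcy. destruct (phi_range (Rabs (b - a) / 2) u) as [P1 P2]; try lra.
  pose proof (sin_gt_0 _ P1 P2). apply Rmult_lt_0_compat; lra.
Qed.

Lemma arcy_opp a b u : arcy a b (-1) u = - arcy a b 1 u.
Proof. unfold arcy. ring. Qed.

Lemma arcx_inj a b u v : 1 <= Rabs (b - a) -> 0 <= u <= 1 -> 0 <= v <= 1 ->
  arcx a b u = arcx a b v -> u = v.
Proof.
  intros H Hu Hv E. unfold arcx in E.
  assert (b - a <> 0) by (intros e; rewrite e, Rabs_R0 in H; lra).
  assert (C : cos (phi (Rabs (b - a) / 2) u) = cos (phi (Rabs (b - a) / 2) v)).
  { apply (Rmult_eq_reg_l ((b - a) / 2)); lra. }
  set (r := Rabs (b - a) / 2) in *. assert (Hr : 1 / 2 <= r) by (unfold r; lra).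
  assert (G : forall w, 0 <= w <= 1 -> 0 <= phi r w <= PI).
  { intros w Hw. split.
    - destruct (Req_dec w 0) as [->|]; [rewrite phi_0; lra|].
      rewrite <- (phi_0 r). apply Rlt_le, phi_increasing; lra.
    - destruct (Req_dec w 1) as [->|]; [rewrite phi_1; lra|].
      rewrite <- (phi_1 r). apply Rlt_le, phi_increasing; lra. }
  pose proof (G u Hu). pose proof (G v Hv).
  destruct (Rtotal_order u v) as [L|[L|L]]; [|assumption|]; exfalso.
  - assert (phi r u < phi r v) by (apply phi_increasing; lra).
    assert (cos (phi r v) < cos (phi r u)) by (apply cos_decreasing_1; lra). lra.
  - assert (phi r v < phi r u) by (apply phi_increasing; lra).
    assert (cos (phi r u) < cos (phi r v)) by (apply cos_decreasing_1; lra). lra.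
Qed.

Lemma darc_neq a b e u : 1 <= Rabs (b - a) -> e * e = 1 -> 0 <= u <= 1 ->
  (darcx a b u, darcy a b e u) <> (0, 0).
Proof.
  intros H He Hu E. injection E as E1 E2. unfold darcx in E1. unfold darcy in E2.
  pose proof (dphi_pos (Rabs (b - a) / 2) u ltac:(lra) Hu).
  set (f := phi (Rabs (b - a) / 2) u) in *. set (d := dphi (Rabs (b - a) / 2) u) in *.
  assert (b - a <> 0) by (intros z; rewrite z, Rabs_R0 in H; lra).
  assert (e <> 0) by (intros ->; lra).
  apply Rmult_integral in E1 as [E1|E1]; [|lra].
  apply Rmult_integral in E1 as [E1|E1]; [lra|].
  apply Rmult_integral in E2 as [E2|E2]; [|lra].
  apply Rmult_integral in E2 as [E2|E2].
  - apply Rmult_integral in E2 as [E2|E2]; lra.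
  - pose proof (sin2_cos2 f) as S. rewrite E1, E2 in S. unfold Rsqr in S. lra.
Qed.

(** The velocity is a multiple of the radius vector turned by a right angle. The sign of [m] tells
    whether the semicircle is run from left to right. *)
Lemma darc_upper a b u : 1 <= Rabs (b - a) -> 0 <= u <= 1 -> exists m, m <> 0 /\
  darcx a b u = m * arcy a b 1 u /\
  darcy a b 1 u = - m * (arcx a b u - (a + b) / 2).
Proof.
  intros H Hu. pose proof (dphi_pos (Rabs (b - a) / 2) u ltac:(lra) Hu).
  unfold darcx, darcy, arcx, arcy.
  set (d := dphi (Rabs (b - a) / 2) u) in *. set (f := phi (Rabs (b - a) / 2) u).
  destruct (Rle_lt_dec a b) as [L|L].
  - exists d. rewrite Rabs_pos_eq by lra. split; [lra|split; field].
  - exists (- d). rewrite Rabs_left by lra. split; [lra|split; field].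
Qed.

(** * Closed curves from periodic sequences of arcs *)

Definition closed_curve (a e : Z -> R) (p : Z) (t : R) : pt :=
  (glue (fun z => arcx (a z) (a (z + 1)%Z)) (IZR p * t),
   glue (fun z => arcy (a z) (a (z + 1)%Z) (e z)) (IZR p * t)).

Definition closed_curve' (a e : Z -> R) (p : Z) (t : R) : pt :=
  (IZR p * glue (fun z => darcx (a z) (a (z + 1)%Z)) (IZR p * t),
   IZR p * glue (fun z => darcy (a z) (a (z + 1)%Z) (e z)) (IZR p * t)).

Section ClosedCurve.

Variables (a e : Z -> R) (p : Z).
Hypothesis p_pos : (0 < p)%Z.
Hypothesis far : forall z, 1 <= Rabs (a (z + 1)%Z - a z).
Hypothesis e_unit : forall z, e z * e z = 1.
Hypothesis e_alternates : forall z, e (z + 1)%Z = - e z.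
Hypothesis a_periodic : forall z, a (z + p)%Z = a z.
Hypothesis e_periodic : forall z, e (z + p)%Z = e z.

Let glue_arcx z : arcx (a z) (a (z + 1)%Z) 1 = arcx (a (z + 1)%Z) (a (z + 1 + 1)%Z) 0.
Proof. now rewrite arcx_1, arcx_0. Qed.
Let glue_arcy z : arcy (a z) (a (z + 1)%Z) (e z) 1
  = arcy (a (z + 1)%Z) (a (z + 1 + 1)%Z) (e (z + 1)%Z) 0.
Proof. now rewrite arcy_1, arcy_0. Qed.
Let glue_darcx z : darcx (a z) (a (z + 1)%Z) 1 = darcx (a (z + 1)%Z) (a (z + 1 + 1)%Z) 0.
Proof. now rewrite darcx_1, darcx_0. Qed.
Let glue_darcy z : darcy (a z) (a (z + 1)%Z) (e z) 1
  = darcy (a (z + 1)%Z) (a (z + 1 + 1)%Z) (e (z + 1)%Z) 0.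
Proof. now rewrite darcy_1, darcy_0, e_alternates. Qed.

Lemma derive_scaled (f : R -> R) (c t d : R) :
  is_derive f (c * t) d -> is_derive (fun s => f (c * s)) t (c * d).
Proof.
  intros H. evar_last.
  - apply (is_derive_comp f (fun s => c * s)); [exact H|].
    apply (is_derive_scal (fun s => s) t c 1). apply @is_derive_id.
  - unfold scal; simpl. unfold mult; simpl. ring.
Qed.

Lemma closed_curve_derive t : is_dvec (closed_curve a e p) t (closed_curve' a e p t).
Proof.
  split; simpl.
  - apply (derive_scaled (glue (fun z => arcx (a z) (a (z + 1)%Z)))).
    apply (glue_derive (fun z => arcx (a z) (a (z + 1)%Z)) (fun z => darcx (a z) (a (z + 1)%Z)));
      auto using arcx_derive.
  - apply (derive_scaled (glue (fun z => arcy (a z) (a (z + 1)%Z) (e z)))).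
    apply (glue_derive (fun z => arcy (a z) (a (z + 1)%Z) (e z))
      (fun z => darcy (a z) (a (z + 1)%Z) (e z))); auto using arcy_derive.
Qed.

Lemma dvec_closed_curve t : dvec (closed_curve a e p) t = closed_curve' a e p t.
Proof.
  destruct (closed_curve_derive t) as [H1 H2].
  apply injective_projections; apply is_derive_unique; assumption.
Qed.

Lemma closed_curve_immersed : immersed_circle (closed_curve a e p).
Proof.
  assert (C : forall f, (forall s, continuous (glue f) s) ->
    forall t, continuous (fun s => IZR p * glue f (IZR p * s)) t).
  { intros f Cf t. apply (continuous_scal_r (IZR p) (fun s => glue f (IZR p * s))).
    apply (continuous_comp (fun s => IZR p * s) (glue f)); [|apply Cf].
    apply (ex_derive_continuous (fun s => IZR p * s)). now auto_derive. }
  split; [|split; [|split]].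
  - intros t. unfold closed_curve, glue.
    replace (Int_part (IZR p * (t + 1))) with (Int_part (IZR p * t) + p)%Z.
    + set (z := Int_part _). rewrite plus_IZR.
      replace (z + p + 1)%Z with (z + 1 + p)%Z by ring.
      rewrite !a_periodic, e_periodic.
      replace (IZR p * (t + 1) - (IZR z + IZR p)) with (IZR p * t - IZR z) by ring.
      reflexivity.
    + symmetry. apply Int_part_unique. rewrite plus_IZR.
      pose proof (Int_part_bounds (IZR p * t)). lra.
  - intros t. destruct (closed_curve_derive t) as [H1 H2]. split; eexists; eassumption.
  - intros t. split.
    + eapply continuous_ext; [intros s; rewrite dvec_closed_curve; reflexivity|].
      apply C. intros s. apply glue_continuous; auto using darcx_continuous.
    + eapply continuous_ext; [intros s; rewrite dvec_closed_curve; reflexivity|].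
      apply C. intros s. apply glue_continuous; auto using darcy_continuous.
  - intros t. rewrite dvec_closed_curve. unfold closed_curve', glue.
    set (z := Int_part _). set (u := _ - IZR z). intros E. injection E as E1 E2.
    assert (0 < IZR p) by now apply IZR_lt.
    apply Rmult_integral in E1 as [E1|E1]; [lra|].
    apply Rmult_integral in E2 as [E2|E2]; [lra|].
    apply (darc_neq (a z) (a (z + 1)%Z) (e z) u); auto.
    + pose proof (Int_part_bounds (IZR p * t)). unfold u, z. lra.
    + now rewrite E1, E2.
Qed.

End ClosedCurve.

(** * Sites of the letters *)

Open Scope nat_scope.

(* Every block of sites ends with a spare index, so that the heads of empty words also get
   room on the axis. *)
Definition stride {S : Type} (ws : list (word S)) : nat := Datatypes.S (list_max (map (@length _) ws)).

Definition sites {S : Type} (ws : list (word S)) : list nat :=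
  flat_map (fun i => seq (i * stride ws) (length (nth i ws []))) (seq 0 (length ws)).

(** Index [i * stride ws + j] stands for letter [j] of word [i]. The default [d] is never read at a
    site; it only makes the function total. *)
Definition site_letter {S : Type} (d : S * bool) (ws : list (word S)) (k : nat) : S * bool :=
  nth (k mod stride ws) (nth (k / stride ws) ws []) d.

Lemma length_lt_stride {S : Type} (ws : list (word S)) i : length (nth i ws []) < stride ws.
Proof.
  unfold stride. apply Nat.lt_succ_r.
  destruct (Nat.lt_ge_cases i (length ws)) as [H|H].
  - pose proof (proj1 (list_max_le (map (@length _) ws) _) (le_n _)) as F.
    rewrite Forall_forall in F. apply F. apply in_map, nth_In, H.
  - rewrite nth_overflow by exact H. simpl. lia.
Qed.

Lemma stride_div {S : Type} (ws : list (word S)) i j : j < stride ws ->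
  (i * stride ws + j) / stride ws = i /\ (i * stride ws + j) mod stride ws = j.
Proof.
  intros H. split.
  - rewrite Nat.div_add_l by (unfold stride; lia). rewrite Nat.div_small by exact H. lia.
  - rewrite Nat.add_comm, Nat.Div0.mod_add. now apply Nat.mod_small.
Qed.

Lemma in_block {S : Type} (ws : list (word S)) i k :
  In k (seq (i * stride ws) (length (nth i ws []))) <->
  k / stride ws = i /\ k mod stride ws < length (nth i ws []).
Proof.
  pose proof (length_lt_stride ws i) as L. rewrite in_seq. split.
  - intros [H1 H2]. replace k with (i * stride ws + (k - i * stride ws)) by lia.
    destruct (stride_div ws i (k - i * stride ws)) as [-> ->]; lia.
  - intros [<- H]. pose proof (Nat.div_mod_eq k (stride ws)). lia.
Qed.

Lemma in_sites {S : Type} (ws : list (word S)) k :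
  In k (sites ws) <->
  k / stride ws < length ws /\ k mod stride ws < length (nth (k / stride ws) ws []).
Proof.
  unfold sites. rewrite in_flat_map. split.
  - intros (i & Hi & Hk). apply in_block in Hk as [<- Hk]. apply in_seq in Hi. split; [lia|auto].
  - intros [H1 H2]. exists (k / stride ws). rewrite in_block. split; [apply in_seq; lia|auto].
Qed.

Lemma map_block {S : Type} d (ws : list (word S)) i :
  map (site_letter d ws) (seq (i * stride ws) (length (nth i ws []))) = nth i ws [].
Proof.
  apply nth_ext with d d; [now rewrite length_map, length_seq|].
  intros j. rewrite length_map, length_seq. intros H.
  rewrite (nth_indep _ d (site_letter d ws 0)) by now rewrite length_map, length_seq.
  rewrite map_nth, seq_nth by exact H. unfold site_letter.
  destruct (stride_div ws i j) as [-> ->]; [|reflexivity].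
  pose proof (length_lt_stride ws i). lia.
Qed.

Lemma map_sites {S : Type} d (ws : list (word S)) :
  map (site_letter d ws) (sites ws) = concat ws.
Proof.
  unfold sites. rewrite flat_map_concat_map, concat_map, map_map. f_equal.
  apply nth_ext with [] []; [now rewrite length_map, length_seq|].
  intros i. rewrite length_map, length_seq. intros H.
  rewrite (nth_indep _ [] ((fun i => map (site_letter d ws)
    (seq (i * stride ws) (length (nth i ws [])))) 0)) by now rewrite length_map, length_seq.
  rewrite (map_nth (fun i => map (site_letter d ws)
    (seq (i * stride ws) (length (nth i ws []))))), seq_nth by exact H.
  apply map_block.
Qed.

Lemma StronglySorted_append (l1 l2 : list nat) :
  StronglySorted lt l1 -> StronglySorted lt l2 ->
  (forall x y, In x l1 -> In y l2 -> x < y) -> StronglySorted lt (l1 ++ l2).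
Proof.
  induction l1 as [|x l1 IH]; simpl; intros S1 S2 H; [assumption|].
  inversion_clear S1 as [|? ? S3 F]. constructor; [auto|].
  apply Forall_app. split; [assumption|]. apply Forall_forall. auto.
Qed.

Lemma StronglySorted_seq a n : StronglySorted lt (seq a n).
Proof.
  revert a; induction n as [|n IH]; intros a; constructor; auto.
  apply Forall_forall. intros x Hx. apply in_seq in Hx. lia.
Qed.

Lemma sites_sorted {S : Type} (ws : list (word S)) : StronglySorted lt (sites ws).
Proof.
  unfold sites. generalize 0. induction (length ws) as [|n IH]; intros a; simpl; [constructor|].
  apply StronglySorted_append; auto using StronglySorted_seq.
  intros x y Hx Hy. apply in_flat_map in Hy as (i & Hi & Hy).
  apply in_seq in Hx, Hy, Hi. pose proof (length_lt_stride ws a).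
  assert (a * stride ws + stride ws <= i * stride ws) by nia. lia.
Qed.

(** [inn] gives the upper arcs and [out] the lower ones. The conditions differ: upper arcs may cross
    but stay in a block, lower arcs may join blocks but do not cross. *)
Record arc_scheme {S : Type} (lett : nat -> S * bool) (K : list nat) (blk inn out : nat -> nat)
  : Prop := {
  inn_matching : matching lett K inn;
  inn_block : forall k, In k K -> blk (inn k) = blk k;
  out_matching : matching lett K out;
  out_noncrossing : noncrossing K out
}.

Lemma arc_scheme_exists {S : Type} d (ws : list (word S)) : commutator_identity ws ->
  exists inn out, arc_scheme (site_letter d ws) (sites ws) (fun k => k / stride ws) inn out.
Proof.
  intros [Hc Hf].
  assert (Hin : forall i, exists f, matching (site_letter d ws)
    (seq (i * stride ws) (length (nth i ws []))) f).
  { intros i. apply balanced_matching; [apply seq_NoDup|]. intros h. rewrite map_block.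
    destruct (Nat.lt_ge_cases i (length ws)) as [H|H].
    - apply exponent_sum_commutator. rewrite Forall_forall in Hc. apply Hc, nth_In, H.
    - now rewrite nth_overflow. }
  set (F := fun i => proj1_sig (constructive_indefinite_description _ (Hin i))).
  assert (HF : forall i, matching (site_letter d ws)
    (seq (i * stride ws) (length (nth i ws []))) (F i)).
  { intros i. unfold F. apply proj2_sig. }
  destruct (nested_matching (site_letter d ws) (concat ws)
    (free_eq_nil_nested _ Hf) (sites ws) (sites_sorted ws) (map_sites d ws)) as (out & M & N).
  (* The partner lies in the same block, so applying the combined function twice uses the same [F i]
     both times. *)
  assert (G : forall k, In k (sites ws) ->
    In (F (k / stride ws) k) (sites ws) /\ F (k / stride ws) k / stride ws = k / stride ws /\
    F (k / stride ws) (F (k / stride ws) k) = k /\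
    site_letter d ws (F (k / stride ws) k) = inv_letter (site_letter d ws k)).
  { intros k Hk. apply in_sites in Hk as [H1 H2].
    destruct (HF (k / stride ws) k) as (I & E & L); [now apply in_block|].
    apply in_block in I as [I1 I2]. rewrite in_sites, I1. auto. }
  exists (fun k => F (k / stride ws) k), out. split; auto.
  - intros k Hk. destruct (G k Hk) as (G1 & G2 & G3 & G4). rewrite G2. auto.
  - intros k Hk. apply (G k Hk).
Qed.

(** The recursion is the growth required by [three_semicircles], with [M] the position preceding the
    largest endpoint. *)
Fixpoint zpos (k : nat) : Z :=
  match k with
  | O => 2
  | S k => 4 * (zpos k * zpos k * zpos k)
  end%Z.

Lemma zpos_step k : (2 <= zpos k /\ zpos k < zpos (S k))%Z.
Proof.
  assert (G : forall z, (2 <= z -> 2 <= 4 * (z * z * z) /\ z < 4 * (z * z * z))%Z).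
  { intros z Hz. assert (4 <= z * z)%Z by nia. assert (4 * z <= z * z * z)%Z by nia. lia. }
  assert (H : (2 <= zpos k)%Z) by (induction k; [simpl; lia|now apply G]).
  split; [exact H|now apply G].
Qed.

Lemma zpos_lt k l : k < l -> (zpos k < zpos l)%Z.
Proof.
  induction 1; [apply zpos_step|]. pose proof (zpos_step m). lia.
Qed.

Lemma zpos_le k l : k <= l -> (zpos k <= zpos l)%Z.
Proof.
  intros H. apply Nat.lt_eq_cases in H as [H| ->]; [|lia]. apply zpos_lt in H. lia.
Qed.

Lemma zpos_inj k l : zpos k = zpos l -> k = l.
Proof.
  intros E. destruct (Nat.lt_trichotomy k l) as [H|[H|H]]; auto; apply zpos_lt in H; lia.
Qed.

Open Scope R_scope.

(* The first two equations make [x] a rational number with denominator at most [2M], hence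
   [x - e >= 1/(2M)], and then [f = x + y/(x - e)] is too small. *)
Lemma three_semicircles (M a b c d e f : Z) (x y : R) :
  (0 < a <= M)%Z -> (0 < b <= M)%Z -> (0 < c <= M)%Z -> (0 < d <= M)%Z -> (0 < e <= M)%Z ->
  (4 * (M * M * M) <= f)%Z -> a <> c -> a <> d ->
  (x - IZR a) * (IZR b - x) = y -> (x - IZR c) * (IZR d - x) = y ->
  (x - IZR e) * (IZR f - x) = y -> 0 < y -> False.
Proof.
  intros Ha Hb Hc Hd He Hf ac ad E1 E2 E3 Hy.
  set (s := (a + b - c - d)%Z). set (n := (a * b - c * d - e * s)%Z).
  assert (En : IZR s * (x - IZR e) = IZR n).
  { unfold n, s. repeat rewrite ?minus_IZR, ?plus_IZR, ?mult_IZR. nra. }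
  assert (M1 : (1 <= M)%Z) by lia.
  assert (s0 : s <> 0%Z).
  { intros s0. assert (E : (a * b = c * d)%Z).
    { apply eq_IZR. rewrite !mult_IZR. unfold s in s0.
      assert (IZR a + IZR b = IZR c + IZR d) by (rewrite <- !plus_IZR; f_equal; lia). nra. }
    unfold s in s0. assert (Hz : ((a - c) * (a - d) = 0)%Z) by nia.
    apply Z.mul_eq_0 in Hz. lia. }
  assert (B : forall z, (0 < z <= M)%Z -> 1 <= IZR z <= IZR M).
  { intros z Hz. split; apply IZR_le; lia. }
  apply B in Ha as Ra. apply B in Hb as Rb. apply B in Hc as Rc. apply B in Hd as Rd.
  apply B in He as Re.
  apply IZR_le in Hf. rewrite !mult_IZR in Hf.
  set (m := IZR M) in *.
  assert (m1 : 1 <= m) by (apply IZR_le in M1; exact M1).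
  assert (Hx : 1 < x < m).
  { assert (~ x <= 1) by (intros Hx; nra). assert (~ m <= x) by (intros Hx; nra). lra. }
  assert (fm : m < IZR f) by nra.
  assert (ex : IZR e < x).
  { apply Rnot_le_lt. intros L. nra. }
  assert (sm : Rabs (IZR s) <= 2 * m).
  { unfold s. repeat rewrite ?minus_IZR, ?plus_IZR. apply Rabs_le. lra. }
  assert (n1 : 1 <= Rabs (IZR n)).
  { rewrite Rabs_Zabs. apply IZR_le. 
    assert (n <> 0%Z); [|lia]. intros n0. rewrite n0 in En.
    apply Rmult_integral in En as [En|En]; [|lra]. apply eq_IZR in En. lia. }
  rewrite <- En, Rabs_mult, (Rabs_pos_eq (x - IZR e)) in n1 by lra.
  assert (lo : 1 <= 2 * m * (x - IZR e)).
  { apply Rle_trans with (1 := n1). apply Rmult_le_compat_r; lra. }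
  assert (ym : y < m * m).
  { rewrite <- E1. assert (0 < x - IZR a /\ 0 < IZR b - x \/ x - IZR a < 0 /\ IZR b - x < 0).
    { destruct (Rtotal_order (x - IZR a) 0) as [|[z|]]; [right|rewrite z in E1; lra|left];
      split; auto; nra. }
    nra. }
  assert (IZR f - x <= 2 * m * y).
  { rewrite <- E3. nra. }
  (* Hence [IZR f] is below [m + 2 * m ^ 3], so below [3 * m ^ 3]; this contradicts the factor 4 in
     the hypothesis on [f]. *)
  assert (2 * m * y < 2 * m * (m * m)) by (apply Rmult_lt_compat_l; lra).
  assert (m <= m * m * m) by nra. nra.
Qed.

(** * The diagram *)

Definition abscissa (k : nat) : R := IZR (zpos k).
Arguments abscissa k%_nat_scope.

Lemma abscissa_lt k l : (k < l)%nat -> abscissa k + 1 <= abscissa l.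
Proof.
  intros H. apply zpos_lt in H. unfold abscissa. rewrite <- plus_IZR. apply IZR_le. lia.
Qed.

Lemma abscissa_inj k l : abscissa k = abscissa l -> k = l.
Proof. intros H. now apply zpos_inj, eq_IZR. Qed.

Lemma abscissa_ge_2 k : 2 <= abscissa k.
Proof. apply IZR_le, zpos_step. Qed.

Lemma abscissa_far k l : k <> l -> 1 <= Rabs (abscissa l - abscissa k).
Proof.
  intros H. destruct (Nat.lt_gt_cases k l) as [G _]. destruct (G H) as [L|L]; apply abscissa_lt in L.
  - rewrite Rabs_pos_eq; lra.
  - rewrite Rabs_left; lra.
Qed.

Lemma no_triple_point_max (a b c d e f : nat) (x y : R) :
  (a < f)%nat -> (b < f)%nat -> (c < f)%nat -> (d < f)%nat -> (e < f)%nat ->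
  a <> c -> a <> d ->
  (x - abscissa a) * (abscissa b - x) = y -> (x - abscissa c) * (abscissa d - x) = y ->
  (x - abscissa e) * (abscissa f - x) = y -> 0 < y -> False.
Proof.
  intros La Lb Lc Ld Le ac ad E1 E2 E3 Hy.
  assert (B : forall k, (k < f)%nat -> (0 < zpos k <= zpos (f - 1))%Z).
  { intros k Hk. split; [pose proof (zpos_step k); lia|]. apply zpos_le. lia. }
  apply (three_semicircles (zpos (f - 1)) (zpos a) (zpos b) (zpos c) (zpos d) (zpos e) (zpos f) x y);
    auto.
  - destruct f as [|f]; [lia|]. simpl. rewrite Nat.sub_0_r. lia.
  - intros E. apply zpos_inj in E. auto.
  - intros E. apply zpos_inj in E. auto.
Qed.

(** The circle equation is symmetric in its two ends, and the three semicircles are interchangeable;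
    so whichever index is largest can play the part of [f] in [no_triple_point_max]. *)
Lemma no_triple_point (a b c d e f : nat) (x y : R) :
  NoDup [a; b; c; d; e; f] ->
  (x - abscissa a) * (abscissa b - x) = y -> (x - abscissa c) * (abscissa d - x) = y ->
  (x - abscissa e) * (abscissa f - x) = y -> 0 < y -> False.
Proof.
  intros N E1 E2 E3 Hy.
  set (top := fun m : nat => (a <= m /\ b <= m /\ c <= m /\ d <= m /\ e <= m /\ f <= m)%nat).
  assert (T : top a \/ top b \/ top c \/ top d \/ top e \/ top f) by (unfold top; lia).
  unfold top in T. clear top.
  repeat match goal with H : NoDup (_ :: _) |- _ => inversion_clear H end. simpl in *.
  repeat match goal with H : ~ (_ \/ _) |- _ => apply not_or_and in H as [? ?] end.
  assert (C1 : (x - abscissa b) * (abscissa a - x) = y) by (rewrite <- E1; ring).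
  assert (C2 : (x - abscissa d) * (abscissa c - x) = y) by (rewrite <- E2; ring).
  assert (C3 : (x - abscissa f) * (abscissa e - x) = y) by (rewrite <- E3; ring).
  destruct T as [T|[T|[T|[T|[T|T]]]]]; destruct T as (T1 & T2 & T3 & T4 & T5 & T6).
  - apply (no_triple_point_max c d e f b a x y); first [apply Nat.le_neq; split; auto | auto].
  - apply (no_triple_point_max c d e f a b x y); first [apply Nat.le_neq; split; auto | auto].
  - apply (no_triple_point_max a b e f d c x y); first [apply Nat.le_neq; split; auto | auto].
  - apply (no_triple_point_max a b e f c d x y); first [apply Nat.le_neq; split; auto | auto].
  - apply (no_triple_point_max a b c d f e x y); first [apply Nat.le_neq; split; auto | auto].
  - apply (no_triple_point_max a b c d e f x y); first [apply Nat.le_neq; split; auto | auto].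
Qed.

Lemma product_pos_between (a b x : R) : a < b -> 0 < (x - a) * (b - x) -> a < x < b.
Proof.
  intros L H. split; apply Rnot_le_lt; intros N.
  - assert (0 <= (a - x) * (b - x)) by (apply Rmult_le_pos; lra). lra.
  - assert (0 <= (x - a) * (x - b)) by (apply Rmult_le_pos; lra). lra.
Qed.

(** Non-interleaved diameters are disjoint, and then no [x] lies over both, or nested, and then the
    inner product is strictly smaller. Listing both orientations of each pair in the hypothesis
    spares an ordering of the ends. *)
Lemma noncrossing_semicircles_disjoint (a b c d : nat) (x y : R) :
  NoDup [a; b; c; d] ->
  (forall k l m n : nat, In (k, l) [(a, b); (b, a); (c, d); (d, c)] ->
    In (m, n) [(a, b); (b, a); (c, d); (d, c)] -> ~ (k < m /\ m < l /\ l < n)%nat) ->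
  (x - abscissa a) * (abscissa b - x) = y -> (x - abscissa c) * (abscissa d - x) = y -> 0 < y -> False.
Proof.
  assert (G : forall a b c d : nat, (a < b)%nat -> (c < d)%nat ->
    (b < c \/ d < a \/ (a < c /\ d < b) \/ (c < a /\ b < d))%nat ->
    (x - abscissa a) * (abscissa b - x) = y -> (x - abscissa c) * (abscissa d - x) = y -> 0 < y -> False).
  { clear a b c d. intros a b c d Lab Lcd Cs E1 E2 Hy.
    apply abscissa_lt in Lab, Lcd.
    assert (B1 : abscissa a < x < abscissa b) by (apply product_pos_between; lra).
    assert (B2 : abscissa c < x < abscissa d) by (apply product_pos_between; lra).
    destruct Cs as [L|[L|[[L1 L2]|[L1 L2]]]].
    - apply abscissa_lt in L. lra.
    - apply abscissa_lt in L. lra.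
    - apply abscissa_lt in L1, L2.
      assert ((x - abscissa c) * (abscissa d - x) < (x - abscissa a) * (abscissa b - x)); [|lra].
      apply Rmult_le_0_lt_compat; lra.
    - apply abscissa_lt in L1, L2.
      assert ((x - abscissa a) * (abscissa b - x) < (x - abscissa c) * (abscissa d - x)); [|lra].
      apply Rmult_le_0_lt_compat; lra. }
  intros N NC E1 E2 Hy.
  repeat match goal with H : NoDup (_ :: _) |- _ => inversion_clear H end. simpl in *.
  pose proof (NC a b c d). pose proof (NC a b d c). pose proof (NC b a c d).
  pose proof (NC b a d c). pose proof (NC c d a b). pose proof (NC c d b a).
  pose proof (NC d c a b). pose proof (NC d c b a). clear NC.
  assert (C1 : (x - abscissa b) * (abscissa a - x) = y) by (rewrite <- E1; ring).
  assert (C2 : (x - abscissa d) * (abscissa c - x) = y) by (rewrite <- E2; ring).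
  destruct (Nat.lt_total a b) as [L|[L|L]], (Nat.lt_total c d) as [L'|[L'|L']]; try lia.
  - apply (G a b c d); auto. intuition lia.
  - apply (G a b d c); auto. intuition lia.
  - apply (G b a c d); auto. intuition lia.
  - apply (G b a d c); auto. intuition lia.
Qed.

(** The other end of the arc that leaves site [k]. Since partners carry inverse letters, the arc
    leaving that end is on the opposite side. *)
Definition next {S : Type} (lett : nat -> S * bool) (inn out : nat -> nat) (k : nat) : nat :=
  if snd (lett k) then out k else inn k.

Definition side {S : Type} (lett : nat -> S * bool) (k : nat) : R :=
  if snd (lett k) then -1 else 1.

Section Diagram.

Context {S : Type} (lett : nat -> S * bool) (K : list nat) (blk inn out : nat -> nat).
Hypothesis scheme : arc_scheme lett K blk inn out.

Let nxt := next lett inn out.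
Let sg := side lett.

Lemma next_site k : In k K -> In (nxt k) K.
Proof.
  intros H. unfold nxt, next.
  destruct (snd (lett k)); [apply (out_matching _ _ _ _ _ scheme)|apply (inn_matching _ _ _ _ _ scheme)]; exact H.
Qed.

Lemma next_letter k : In k K -> lett (nxt k) = inv_letter (lett k).
Proof.
  intros H. unfold nxt, next.
  destruct (snd (lett k)); [apply (out_matching _ _ _ _ _ scheme)|apply (inn_matching _ _ _ _ _ scheme)]; exact H.
Qed.

Lemma next_neq k : In k K -> nxt k <> k.
Proof.
  intros H E. apply (inv_letter_neq (lett k)). rewrite <- next_letter, E; auto.
Qed.

(** The letter of the image determines the letter of the source, so both sites use the same one of
    the two involutions. *)
Lemma next_inj k l : In k K -> In l K -> nxt k = nxt l -> k = l.
Proof.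
  intros Hk Hl E.
  assert (Es : snd (lett k) = snd (lett l)).
  { pose proof (next_letter k Hk) as E1. rewrite E, next_letter in E1 by exact Hl.
    rewrite <- (inv_letterK (lett k)), <- E1, inv_letterK. reflexivity. }
  unfold nxt, next in E. rewrite Es in E. destruct (snd (lett l)).
  - destruct (out_matching _ _ _ _ _ scheme k Hk) as (_ & <- & _).
    destruct (out_matching _ _ _ _ _ scheme l Hl) as (_ & <- & _). now rewrite E.
  - destruct (inn_matching _ _ _ _ _ scheme k Hk) as (_ & <- & _).
    destruct (inn_matching _ _ _ _ _ scheme l Hl) as (_ & <- & _). now rewrite E.
Qed.

Lemma next_far k : In k K -> 1 <= Rabs (abscissa (nxt k) - abscissa k).
Proof. intros H. apply abscissa_far. intros E. symmetry in E. now apply next_neq in E. Qed.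

Lemma side_sqr k : sg k * sg k = 1.
Proof. unfold sg, side. destruct (snd (lett k)); ring. Qed.

Lemma side_next k : In k K -> sg (nxt k) = - sg k.
Proof.
  intros H. unfold sg, side. rewrite next_letter by exact H. unfold inv_letter. simpl.
  destruct (snd (lett k)); simpl; ring.
Qed.

Definition arc (k : nat) (u : R) : pt :=
  (arcx (abscissa k) (abscissa (nxt k)) u, arcy (abscissa k) (abscissa (nxt k)) (sg k) u).
Definition darc (k : nat) (u : R) : pt :=
  (darcx (abscissa k) (abscissa (nxt k)) u, darcy (abscissa k) (abscissa (nxt k)) (sg k) u).

Lemma arc_0 k : arc k 0 = (abscissa k, 0).
Proof. unfold arc. now rewrite arcx_0, arcy_0. Qed.

Lemma darc_0 k : In k K -> darc k 0 = (0, sg k).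
Proof. intros H. unfold darc. now rewrite darcx_0, darcy_0 by now apply next_far. Qed.

Lemma arc_side k u : In k K -> 0 < u < 1 -> 0 < sg k * snd (arc k u).
Proof.
  intros H Hu. pose proof (arcy_pos (abscissa k) (abscissa (nxt k)) u (next_far k H) Hu).
  unfold arc, sg, side; simpl. destruct (snd (lett k)); [rewrite arcy_opp|]; lra.
Qed.

Lemma arc_eq k u : (fst (arc k u) - abscissa k) * (abscissa (nxt k) - fst (arc k u)) = snd (arc k u) * snd (arc k u).
Proof. apply arc_circle, side_sqr. Qed.

Lemma arc_sqr_pos k u : In k K -> 0 < u < 1 -> 0 < snd (arc k u) * snd (arc k u).
Proof. intros H Hu. pose proof (arc_side k u H Hu). nra. Qed.

(** On a given side arcs start at letters of one sign and end at letters of the other, so a start is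
    never an end. *)
Lemma same_side_distinct k l : In k K -> In l K -> snd (lett k) = snd (lett l) -> k <> l ->
  NoDup [k; nxt k; l; nxt l].
Proof.
  intros Hk Hl E N.
  assert (D : forall a b, In a K -> In b K -> snd (lett a) = snd (lett b) -> nxt a <> b).
  { intros a b Ha Hb Eab F. rewrite <- F, next_letter in Eab by exact Ha.
    destruct (lett a) as [? []]; discriminate. }
  pose proof (D k k Hk Hk eq_refl). pose proof (D l l Hl Hl eq_refl).
  pose proof (D k l Hk Hl E). pose proof (D l k Hl Hk (eq_sym E)).
  assert (nxt k <> nxt l) by (intros F; apply next_inj in F; auto).
  repeat constructor; simpl; intuition congruence.
Qed.

Lemma lower_arcs_disjoint k l u v : In k K -> In l K -> k <> l ->
  snd (lett k) = true -> snd (lett l) = true -> 0 < u < 1 -> 0 < v < 1 ->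
  arc k u <> arc l v.
Proof.
  intros Hk Hl N Sk Sl Hu Hv E.
  pose proof (arc_eq k u) as E1. pose proof (arc_eq l v) as E2. rewrite <- E in E2.
  refine (noncrossing_semicircles_disjoint _ _ _ _ _ _ _ _ E1 E2 (arc_sqr_pos k u Hk Hu)).
  - apply same_side_distinct; congruence.
  - assert (Ek : nxt k = out k) by (unfold nxt, next; now rewrite Sk).
    assert (El : nxt l = out l) by (unfold nxt, next; now rewrite Sl).
    destruct (out_matching _ _ _ _ _ scheme k Hk) as (Ik & Ok & _).
    destruct (out_matching _ _ _ _ _ scheme l Hl) as (Il & Ol & _).
    rewrite Ek, El.
    assert (G : forall a b, In (a, b) [(k, out k); (out k, k); (l, out l); (out l, l)] ->
      In a K /\ b = out a).
    { simpl. intros a b I. repeat destruct I as [I|I]; try contradiction;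
        injection I as <- <-; auto. }
    intros a b c d I J. apply G in I as [Ia ->]. apply G in J as [Ic ->].
    now apply (out_noncrossing _ _ _ _ _ scheme).
Qed.

(** Arcs are half-open, so each site belongs only to the arc leaving it. Off the axis, opposite
    sides are disjoint and lower arcs do not meet, which leaves two upper arcs. *)
Lemma arc_meet k l u v : In k K -> In l K -> 0 <= u < 1 -> 0 <= v < 1 -> arc k u = arc l v ->
  (k = l /\ u = v) \/
  (k <> l /\ snd (lett k) = false /\ snd (lett l) = false /\ 0 < u /\ 0 < v).
Proof.
  intros Hk Hl Hu Hv E.
  assert (Z : forall a b w, In a K -> In b K -> 0 <= w < 1 -> arc a 0 = arc b w -> a = b /\ 0 = w).
  { intros a b w Ha Hb Hw F. rewrite arc_0 in F.
    destruct (Rle_lt_or_eq_dec 0 w) as [L|<-]; [lra| |].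
    - exfalso. pose proof (arc_side b w Hb ltac:(lra)) as P. rewrite <- F in P. simpl in P. lra.
    - rewrite arc_0 in F. injection F as F. apply abscissa_inj in F. auto. }
  destruct (Rle_lt_or_eq_dec 0 u) as [Lu|<-]; [lra| |left; auto].
  destruct (Rle_lt_or_eq_dec 0 v) as [Lv|<-]; [lra| |].
  2: { left. destruct (Z l k u) as [-> ->]; auto. }
  destruct (Nat.eq_dec k l) as [->|N].
  { left. split; auto. injection E as E _. eapply arcx_inj; [|lra|lra|exact E].
    now apply next_far. }
  right. pose proof (arc_side k u Hk ltac:(lra)) as Pk. pose proof (arc_side l v Hl ltac:(lra)) as Pl.
  rewrite <- E in Pl. unfold sg, side in Pk, Pl.
  destruct (snd (lett k)) eqn:Sk, (snd (lett l)) eqn:Sl; try lra; auto.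
  exfalso. apply (lower_arcs_disjoint k l u v); auto; lra.
Qed.

Lemma upper_arcs_no_triple k1 k2 k3 u1 u2 u3 :
  In k1 K -> In k2 K -> In k3 K -> k1 <> k2 -> k1 <> k3 -> k2 <> k3 ->
  snd (lett k1) = false -> snd (lett k2) = false -> snd (lett k3) = false -> 0 < u1 < 1 ->
  arc k1 u1 = arc k2 u2 -> arc k1 u1 = arc k3 u3 -> False.
Proof.
  intros H1 H2 H3 N12 N13 N23 S1 S2 S3 Hu E12 E13.
  pose proof (arc_eq k1 u1) as E1. pose proof (arc_eq k2 u2) as E2. rewrite <- E12 in E2.
  pose proof (arc_eq k3 u3) as E3. rewrite <- E13 in E3.
  refine (no_triple_point _ _ _ _ _ _ _ _ _ E1 E2 E3 (arc_sqr_pos k1 u1 H1 Hu)).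
  pose proof (same_side_distinct k1 k2 H1 H2 ltac:(congruence) N12) as D1.
  pose proof (same_side_distinct k1 k3 H1 H3 ltac:(congruence) N13) as D2.
  pose proof (same_side_distinct k2 k3 H2 H3 ltac:(congruence) N23) as D3.
  clear - D1 D2 D3.
  repeat match goal with H : NoDup (_ :: _) |- _ => inversion_clear H end.
  simpl in *. repeat constructor; simpl; intuition congruence.
Qed.

(** The determinant of the turned radius vectors is a nonzero multiple of the distance between the
    centres. Concentric circles with a common point coincide, which would make an end of one arc an
    end of the other. *)
Lemma upper_arcs_transverse k l u v : In k K -> In l K -> k <> l ->
  snd (lett k) = false -> snd (lett l) = false -> 0 < u < 1 -> 0 < v < 1 ->
  arc k u = arc l v -> det (darc k u) (darc l v) <> 0.
Proof.
  intros Hk Hl N Sk Sl Hu Hv E.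
  pose proof (same_side_distinct k l Hk Hl ltac:(congruence) N) as D.
  pose proof (arc_eq k u) as E1. pose proof (arc_eq l v) as E2. rewrite <- E in E2.
  pose proof (arc_side k u Hk Hu) as P.
  assert (Ek : sg k = 1) by (unfold sg, side; now rewrite Sk).
  assert (El : sg l = 1) by (unfold sg, side; now rewrite Sl).
  destruct (darc_upper (abscissa k) (abscissa (nxt k)) u (next_far k Hk) ltac:(lra)) as (m & m0 & Hm1 & Hm2).
  destruct (darc_upper (abscissa l) (abscissa (nxt l)) v (next_far l Hl) ltac:(lra)) as (n & n0 & Hn1 & Hn2).
  unfold det, darc. simpl. rewrite Ek, El, Hm1, Hm2, Hn1, Hn2.
  assert (Ex : arcx (abscissa l) (abscissa (nxt l)) v = fst (arc k u)) by now rewrite E.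
  assert (Ey : arcy (abscissa l) (abscissa (nxt l)) 1 v = snd (arc k u)).
  { rewrite E. unfold arc. simpl. now rewrite El. }
  assert (Ey' : arcy (abscissa k) (abscissa (nxt k)) 1 u = snd (arc k u)).
  { unfold arc. simpl. now rewrite Ek. }
  rewrite Ex, Ey, Ey'. change (arcx (abscissa k) (abscissa (nxt k)) u) with (fst (arc k u)).
  rewrite Ek in P. set (x := fst (arc k u)) in *. set (y := snd (arc k u)) in *.
  replace (m * y * (- n * (x - (abscissa l + abscissa (nxt l)) / 2)) -
    - m * (x - (abscissa k + abscissa (nxt k)) / 2) * (n * y))
    with (m * n * y * ((abscissa l + abscissa (nxt l) - abscissa k - abscissa (nxt k)) / 2)) by field.
  assert (C : abscissa l + abscissa (nxt l) - abscissa k - abscissa (nxt k) <> 0).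
  { intros C.
    assert (Ep : (abscissa k - abscissa l) * (abscissa k - abscissa (nxt l)) = 0) by nra.
    inversion_clear D. simpl in *.
    apply Rmult_integral in Ep as [Ep|Ep]; apply Rminus_diag_uniq, abscissa_inj in Ep; auto. }
  apply Rmult_integral_contrapositive_currified; [|lra].
  apply Rmult_integral_contrapositive_currified; [|lra].
  now apply Rmult_integral_contrapositive_currified.
Qed.

(** * From the cycles of arcs to the doodle diagram *)

Context (cyc : list (nat * nat)).
Hypothesis cycles : cycle_decomposition nxt K cyc.

Definition vertex (r p : nat) (z : Z) : nat := Nat.iter (Z.to_nat (z mod Z.of_nat p)) nxt r.

Definition component_of (c : nat * nat) : component S :=
  Comp (fst (lett (fst c)))
    (closed_curve (fun z => abscissa (vertex (fst c) (snd c) z))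
       (fun z => sg (vertex (fst c) (snd c) z)) (Z.of_nat (snd c))).

Definition diagram : list (component S) := map component_of cyc.

Lemma cycle_in i r p : nth_error cyc i = Some (r, p) -> (0 < p)%nat /\ Nat.iter p nxt r = r /\ In r K.
Proof. apply cycles. Qed.

Lemma iter_next_site r n : In r K -> In (Nat.iter n nxt r) K.
Proof. intros H. induction n; simpl; [exact H|now apply next_site]. Qed.

Lemma iter_next_label r n : In r K -> fst (lett (Nat.iter n nxt r)) = fst (lett r).
Proof.
  intros H. induction n; simpl; [reflexivity|].
  rewrite next_letter by now apply iter_next_site. exact IHn.
Qed.

Lemma vertex_succ i r p z : nth_error cyc i = Some (r, p) -> vertex r p (z + 1) = nxt (vertex r p z).
Proof.
  intros H. apply cycle_in in H as (p0 & E & _). unfold vertex.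
  pose proof (Z.mod_pos_bound z (Z.of_nat p) ltac:(lia)) as B.
  rewrite <- Zplus_mod_idemp_l.
  set (m := (z mod Z.of_nat p)%Z) in *.
  destruct (Z.eq_dec (m + 1) (Z.of_nat p)) as [e|e].
  - rewrite e, Z.mod_same by lia. simpl.
    change (nxt (Nat.iter (Z.to_nat m) nxt r)) with (Nat.iter (Datatypes.S (Z.to_nat m)) nxt r).
    replace (Datatypes.S (Z.to_nat m)) with p by lia. congruence.
  - rewrite Z.mod_small by lia. replace (Z.to_nat (m + 1)) with (Datatypes.S (Z.to_nat m)) by lia.
    reflexivity.
Qed.

Lemma vertex_periodic r p z : vertex r p (z + Z.of_nat p) = vertex r p z.
Proof.
  unfold vertex. do 2 f_equal. rewrite <- (Z.mul_1_l (Z.of_nat p)) at 1. apply Z_mod_plus_full.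
Qed.

Lemma diagram_immersed : List.Forall (fun c => immersed_circle (curve c)) diagram.
Proof.
  apply Forall_forall. intros c Hc. apply in_map_iff in Hc as ([r p] & <- & Hc).
  apply In_nth_error in Hc as [i Hi]. destruct (cycle_in _ _ _ Hi) as (p0 & E & Hr).
  assert (HV : forall z, In (vertex r p z) K) by (intros z; now apply iter_next_site).
  apply closed_curve_immersed; simpl; try lia; intros z.
  - rewrite (vertex_succ i) by exact Hi. now apply next_far.
  - apply side_sqr.
  - rewrite (vertex_succ i) by exact Hi. now apply side_next.
  - now rewrite vertex_periodic.
  - now rewrite vertex_periodic.
Qed.

(** Dictionary between the two coordinate systems: component [i] at time [t] is at parameter [u] of
    the arc leaving site [k]. All geometry of the diagram is carried over from arcs through it. *)
Definition strand (i : nat) (t : R) (k : nat) (u : R) : Prop :=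
  exists r p, nth_error cyc i = Some (r, p) /\ 0 <= t < 1 /\
    let z := Int_part (IZR (Z.of_nat p) * t) in
    k = vertex r p z /\ u = IZR (Z.of_nat p) * t - IZR z.

Lemma strand_site i t k u : strand i t k u -> In k K /\ 0 <= u < 1.
Proof.
  intros (r & p & Hi & Ht & -> & ->). apply cycle_in in Hi as (p0 & _ & Hr).
  split; [now apply iter_next_site|].
  pose proof (Int_part_bounds (IZR (Z.of_nat p) * t)). lra.
Qed.

Lemma strand_preimage i t k u : strand i t k u -> preimage diagram (arc k u) i t.
Proof.
  intros (r & p & Hi & Ht & -> & ->).
  split; [|split; [exact Ht|]].
  - unfold diagram. rewrite length_map. apply nth_error_Some. congruence.
  - exists (component_of (r, p)). unfold diagram. split; [now rewrite nth_error_map, Hi|].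
    simpl. unfold closed_curve, glue, arc. now rewrite (vertex_succ i) by exact Hi.
Qed.

Lemma preimage_strand q i t : preimage diagram q i t -> exists k u, strand i t k u /\ arc k u = q.
Proof.
  intros (_ & Ht & c & Hc & Ec). unfold diagram in Hc. rewrite nth_error_map in Hc.
  destruct (nth_error cyc i) as [[r p]|] eqn:Hi; [|discriminate]. injection Hc as <-.
  eexists _, _. split; [exists r, p; repeat split; [exact Hi|lra|lra]|].
  rewrite <- Ec. simpl. unfold closed_curve, glue, arc. now rewrite (vertex_succ i) by exact Hi.
Qed.

Lemma strand_tangent i t k u : strand i t k u -> exists m, 0 < m /\
  tangent diagram i t = (m * fst (darc k u), m * snd (darc k u)).
Proof.
  intros (r & p & Hi & Ht & -> & ->). destruct (cycle_in _ _ _ Hi) as (p0 & _ & Hr).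
  assert (HV : forall z, In (vertex r p z) K) by (intros z; now apply iter_next_site).
  exists (IZR (Z.of_nat p)). split; [apply IZR_lt; lia|].
  unfold tangent, diagram. rewrite nth_error_map, Hi. simpl.
  rewrite dvec_closed_curve; try (intros z).
  - unfold closed_curve', glue. now rewrite (vertex_succ i) by exact Hi.
  - rewrite (vertex_succ i) by exact Hi. now apply next_far.
  - rewrite (vertex_succ i) by exact Hi. now apply side_next.
Qed.

Lemma strand_label i t k u : strand i t k u ->
  exists c, nth_error diagram i = Some c /\ label c = fst (lett k).
Proof.
  intros (r & p & Hi & Ht & -> & ->). destruct (cycle_in _ _ _ Hi) as (p0 & _ & Hr).
  exists (component_of (r, p)). unfold diagram. rewrite nth_error_map, Hi.
  split; [reflexivity|]. simpl. symmetry. now apply iter_next_label.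
Qed.

(** A site occurs once in the cycle decomposition, so [k] fixes the component and the integer part
    of the rescaled time, and [u] its fractional part. *)
Lemma strand_unique i t i' t' k u : strand i t k u -> strand i' t' k u -> (i, t) = (i', t').
Proof.
  intros (r & p & Hi & Ht & Ek & Eu) (r' & p' & Hi' & Ht' & Ek' & Eu').
  assert (B : forall i r p t, nth_error cyc i = Some (r, p) -> 0 <= t < 1 ->
    0 < IZR (Z.of_nat p) /\ (0 <= Int_part (IZR (Z.of_nat p) * t) < Z.of_nat p)%Z).
  { intros j s q x Hj Hx. apply cycle_in in Hj as (q0 & _).
    assert (0 < IZR (Z.of_nat q)) by (apply IZR_lt; lia). split; auto.
    pose proof (Int_part_bounds (IZR (Z.of_nat q) * x)).
    assert (0 <= IZR (Z.of_nat q) * x) by (apply Rmult_le_pos; lra).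
    assert (IZR (Z.of_nat q) * x < IZR (Z.of_nat q) * 1) by (apply Rmult_lt_compat_l; lra).
    split.
    - assert (-1 < Int_part (IZR (Z.of_nat q) * x))%Z by (apply lt_IZR; lra). lia.
    - apply lt_IZR. lra. }
  destruct (B _ _ _ _ Hi Ht) as [p0 Bz]. destruct (B _ _ _ _ Hi' Ht') as [p0' Bz'].
  rewrite Ek in Ek'. unfold vertex in Ek'. rewrite !Z.mod_small in Ek' by assumption.
  destruct cycles as (_ & _ & U).
  apply (U _ _ _ _ _ _ _ _ Hi Hi') in Ek' as [<- Ej]; [|lia|lia].
  rewrite Hi in Hi'. injection Hi' as <- <-. f_equal.
  apply Z2Nat.inj in Ej; try lia. rewrite Ej in Eu.
  apply (Rmult_eq_reg_l (IZR (Z.of_nat p))); lra.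
Qed.

Lemma strand_exists k u : In k K -> 0 <= u < 1 -> exists i t, strand i t k u.
Proof.
  intros Hk Hu. destruct cycles as (_ & Cv & _).
  destruct (Cv k Hk) as (i & r & p & j & Hi & Hj & Ek).
  assert (p0 : 0 < IZR (Z.of_nat p)) by (apply IZR_lt; lia).
  assert (Ez : IZR (Z.of_nat p) * ((IZR (Z.of_nat j) + u) / IZR (Z.of_nat p)) = IZR (Z.of_nat j) + u).
  { field. lra. }
  exists i, ((IZR (Z.of_nat j) + u) / IZR (Z.of_nat p)), r, p.
  rewrite Ez, (Int_part_unique (Z.of_nat j)) by lra.
  assert (0 <= IZR (Z.of_nat j)) by (apply IZR_le; lia).
  assert (IZR (Z.of_nat j) + 1 <= IZR (Z.of_nat p)) by (rewrite <- plus_IZR; apply IZR_le; lia).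
  repeat split; auto.
  - apply Rmult_le_pos; [lra|]. now apply Rlt_le, Rinv_0_lt_compat.
  - apply (Rmult_lt_reg_l (IZR (Z.of_nat p))); lra.
  - unfold vertex. now rewrite Z.mod_small, Nat2Z.id by lia.
  - ring.
Qed.

Lemma diagram_crossing q i t j s :
  preimage diagram q i t -> preimage diagram q j s -> (i, t) <> (j, s) ->
  exists k l u v, strand i t k u /\ strand j s l v /\ arc k u = q /\ arc l v = q /\ k <> l /\
    snd (lett k) = false /\ snd (lett l) = false /\ 0 < u < 1 /\ 0 < v < 1.
Proof.
  intros P Q N. apply preimage_strand in P as (k & u & Su & Eu).
  apply preimage_strand in Q as (l & v & Sv & Ev).
  destruct (strand_site _ _ _ _ Su) as [Hk Hu]. destruct (strand_site _ _ _ _ Sv) as [Hl Hv].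
  exists k, l, u, v. destruct (arc_meet k l u v) as [[-> ->]|M]; auto; [congruence| |].
  - exfalso. apply N. eapply strand_unique; eassumption.
  - intuition lra.
Qed.

Lemma diagram_doodle : doodle diagram.
Proof.
  split; [exact diagram_immersed|split].
  - intros q i1 t1 i2 t2 i3 t3 P1 P2 P3.
    destruct (classic ((i1, t1) = (i2, t2))) as [|N12]; [auto|].
    destruct (classic ((i1, t1) = (i3, t3))) as [|N13]; [auto|].
    destruct (classic ((i2, t2) = (i3, t3))) as [|N23]; [auto|]. exfalso.
    apply preimage_strand in P1 as (k1 & u1 & S1 & E1).
    apply preimage_strand in P2 as (k2 & u2 & S2 & E2).
    apply preimage_strand in P3 as (k3 & u3 & S3 & E3).
    destruct (strand_site _ _ _ _ S1) as [H1 B1]. destruct (strand_site _ _ _ _ S2) as [H2 B2].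
    destruct (strand_site _ _ _ _ S3) as [H3 B3].
    destruct (arc_meet k1 k2 u1 u2) as [[-> ->]|M12]; auto; [congruence| |].
    { apply N12. eapply strand_unique; eassumption. }
    destruct (arc_meet k1 k3 u1 u3) as [[-> ->]|M13]; auto; [congruence| |].
    { apply N13. eapply strand_unique; eassumption. }
    destruct (arc_meet k2 k3 u2 u3) as [[-> ->]|M23]; auto; [congruence| |].
    { apply N23. eapply strand_unique; eassumption. }
    apply (upper_arcs_no_triple k1 k2 k3 u1 u2 u3); intuition (lra || congruence).
  - intros q i t j s P Q N.
    destruct (diagram_crossing _ _ _ _ _ P Q N)
      as (k & l & u & v & Su & Sv & Eu & Ev & Nkl & Sk & Sl & Hu & Hv).
    destruct (strand_site _ _ _ _ Su) as [Hk _]. destruct (strand_site _ _ _ _ Sv) as [Hl _].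
    destruct (strand_tangent _ _ _ _ Su) as (m & m0 & ->).
    destruct (strand_tangent _ _ _ _ Sv) as (n & n0 & ->).
    pose proof (upper_arcs_transverse k l u v Hk Hl Nkl Sk Sl Hu Hv ltac:(congruence)) as T.
    unfold det in *. cbn [fst snd]. intros Z. apply T.
    apply (Rmult_eq_reg_l (m * n)); [|apply Rmult_integral_contrapositive_currified; lra].
    rewrite Rmult_0_r. etransitivity; [|exact Z]. ring.
Qed.

End Diagram.

(** * A noose with a half-elliptic head *)

(* The head is the half-ellipse [0 <= y <= 2H sqrt(1 - ((x - c)/r)^2)]; its flat side
   lies on the x-axis and the neck is its top point [(c, 2H)]. *)
Definition dome_noose (c r H : R) : noose :=
  Noose (fun q => (c - r * snd q, H * (fst q + sqrt (1 - snd q ^ 2))))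
        (fun t => (c * (2 - t), 2 * H + (t - 1))).

Lemma continuous_pair {U V W : UniformSpace} (f : U -> V) (g : U -> W) x :
  continuous f x -> continuous g x -> continuous (fun y => (f y, g y)) x.
Proof.
  intros Hf Hg. apply (continuous_comp_2 f g (fun a b => (a, b))); auto.
  apply continuous_ext with (fun z => z); [now intros []|apply continuous_id].
Qed.

Section Dome.

Variables (c r H : R).
Hypothesis r_pos : 0 < r.
Hypothesis H_pos : 0 < H.

Let n := dome_noose c r H.

(** For fixed second coordinate the chord of the disk, of half-length [s], is carried onto the
    vertical segment from 0 to [2 * H * s]. *)
Lemma dome_head_iff x y :
  Defs.head n (x, y) <-> 0 <= y /\ r ^ 2 * y ^ 2 <= 4 * H ^ 2 * (r ^ 2 - (x - c) ^ 2).
Proof.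
  split.
  - intros ([q1 q2] & Hq & E). unfold in_disk in Hq. simpl in *. injection E as <- <-.
    rewrite Rmult_1_r in *.
    set (s := sqrt (1 - q2 * q2)).
    assert (s0 : 0 <= s) by apply sqrt_pos.
    assert (ss : s * s = 1 - q2 * q2) by (apply sqrt_sqrt; nra).
    assert (b1 : - s <= q1 <= s) by (split; nra).
    assert (y0 : 0 <= H * (q1 + s)) by (apply Rmult_le_pos; lra).
    split; [exact y0|].
    assert (y1 : H * (q1 + s) <= 2 * (H * s)) by nra.
    replace (c - r * q2 - c) with (- r * q2) by ring.
    replace (4 * (H * (H * 1)) * (r * (r * 1) - - r * q2 * (- r * q2 * 1)))
      with (r * r * (4 * (H * H) * (1 - q2 * q2))) by ring.
    rewrite <- ss.
    replace (r * (r * 1)) with (r * r) by ring.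
    apply Rmult_le_compat_l; [nra|]. 
    replace (4 * (H * H) * (s * s)) with (2 * (H * s) * (2 * (H * s))) by ring.
    rewrite Rmult_1_r. apply Rmult_le_compat; lra.
  - intros [y0 E]. set (q := (c - x) / r).
    assert (Eq : r * q = c - x) by (unfold q; field; lra).
    assert (E' : y * y <= 4 * (H * H) * (1 - q * q)).
    { apply (Rmult_le_reg_l (r ^ 2)); [nra|].
      replace (r ^ 2 * (y * y)) with (r ^ 2 * y ^ 2) by ring.
      replace (r ^ 2 * (4 * (H * H) * (1 - q * q)))
        with (4 * H ^ 2 * (r ^ 2 - (r * q) ^ 2)) by ring.
      rewrite Eq. replace ((c - x) ^ 2) with ((x - c) ^ 2) by ring. exact E. }
    assert (q1 : q * q <= 1).
    { apply Rnot_lt_le. intros L. assert (0 < H * H) by nra.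
      assert (0 < (H * H) * (q * q - 1)) by (apply Rmult_lt_0_compat; lra).
      pose proof (pow2_ge_0 y). nra. }
    set (s := sqrt (1 - q * q)).
    assert (s0 : 0 <= s) by apply sqrt_pos.
    assert (ss : s * s = 1 - q * q) by (apply sqrt_sqrt; lra).
    assert (y1 : y <= 2 * (H * s)).
    { rewrite <- ss in E'. apply Rsqr_incr_0_var; [unfold Rsqr; lra|].
      apply Rmult_le_pos; [lra|]. apply Rmult_le_pos; lra. }
    assert (z0 : 0 <= y / H) by (apply Rmult_le_pos; [lra|now apply Rlt_le, Rinv_0_lt_compat]).
    assert (z1 : y / H <= 2 * s).
    { apply (Rmult_le_reg_l H); [lra|]. replace (H * (y / H)) with y by (field; lra). lra. }
    exists (y / H - s, q). split.
    + unfold in_disk. simpl. nra.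
    + simpl. rewrite Rmult_1_r. fold s. f_equal; [lra|field; lra].
Qed.

(** The loop is on the flat side where the cosine is at most 0 and on the elliptic arc where it is
    positive; it starts at the top and descends first to the left. *)
Lemma dome_loop th :
  loop n th = (c - r * sin (2 * PI * th), H * (cos (2 * PI * th) + Rabs (cos (2 * PI * th)))).
Proof.
  unfold loop, n. simpl. set (a := 2 * PI * th). do 3 f_equal.
  rewrite <- sqrt_Rsqr_abs. f_equal. pose proof (sin2_cos2 a). unfold Rsqr in *. lra.
Qed.

Lemma dome_loop_x_derive th :
  is_derive (fun s => fst (loop n s)) th (- (2 * PI * r) * cos (2 * PI * th)).
Proof.
  apply is_derive_ext with (fun s => c - r * sin (2 * PI * s)).
  { intros s. now rewrite dome_loop. }
  auto_derive; [trivial|]. ring.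
Qed.

Lemma dome_loop_y_derive_lower th : cos (2 * PI * th) < 0 ->
  is_derive (fun s => snd (loop n s)) th 0.
Proof.
  intros N. apply is_derive_ext_loc with (fun _ => 0); [|apply @is_derive_const].
  assert (C : continuous (fun s => cos (2 * PI * s)) th).
  { apply (ex_derive_continuous (fun s => cos (2 * PI * s))). now auto_derive. }
  generalize (C _ (open_lt 0 _ N)). unfold filtermap. apply filter_imp. intros s Hs.
  rewrite dome_loop. simpl. rewrite Rabs_left by exact Hs. ring.
Qed.

Lemma dome_loop_y_derive_upper th : 0 < cos (2 * PI * th) ->
  is_derive (fun s => snd (loop n s)) th (- (4 * PI * H) * sin (2 * PI * th)).
Proof.
  intros N. apply is_derive_ext_loc with (fun s => 2 * H * cos (2 * PI * s)).
  - assert (C : continuous (fun s => cos (2 * PI * s)) th).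
    { apply (ex_derive_continuous (fun s => cos (2 * PI * s))). now auto_derive. }
    generalize (C _ (open_gt 0 _ N)). unfold filtermap. apply filter_imp. intros s Hs.
    rewrite dome_loop. simpl. rewrite Rabs_pos_eq by exact (Rlt_le _ _ Hs). ring.
  - auto_derive; [trivial|]. ring.
Qed.

(* At the two corners of the head the height function of the loop has a minimum, so
   that a derivative there would vanish. *)
Lemma dome_loop_corner th v : cos (2 * PI * th) = 0 -> is_dvec (loop n) th v -> v = (0, 0).
Proof.
  intros E [D1 D2]. apply injective_projections; simpl.
  - rewrite <- (is_derive_unique _ _ _ D1), (is_derive_unique _ _ _ (dome_loop_x_derive th)), E.
    ring.
  - apply is_derive_Reals in D2.
    rewrite <- (derive_pt_eq_0 _ _ _ (exist _ (snd v) D2) D2).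
    apply (deriv_minimum _ (th - 1) (th + 1)); try lra.
    intros s _ _. rewrite !dome_loop. simpl. rewrite E, Rabs_R0.
    pose proof (Rle_abs (- cos (2 * PI * s))). rewrite Rabs_Ropp in H0.
    rewrite Rplus_0_r, Rmult_0_r. apply Rmult_le_pos; lra.
Qed.

Lemma dome_rope_above t q : 1 < t -> in_disk q -> rope_map n t <> Defs.head_map n q.
Proof.
  intros Ht Hq E.
  assert (Hh : Defs.head n (rope_map n t)) by (exists q; auto).
  apply dome_head_iff in Hh as [_ Hh].
  set (y := 2 * H + (t - 1)) in Hh.
  assert (y2 : (2 * H) * (2 * H) < y * y) by (unfold y; nra).
  assert (0 < r ^ 2) by nra.
  assert (r ^ 2 * ((2 * H) * (2 * H)) < r ^ 2 * (y * y)) by (apply Rmult_lt_compat_l; lra).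
  assert (0 <= 4 * H ^ 2 * (c * (2 - t) - c) ^ 2)
    by (apply Rmult_le_pos; [nra|apply pow2_ge_0]).
  lra.
Qed.

(** On the flat side the left normal points upwards. The corners have no nonzero derivative. On the
    elliptic arc it points inwards in both coordinates. *)
Lemma dome_left_side th v : is_dvec (loop n) th v -> v <> (0, 0) ->
  exists delta, 0 < delta /\ forall s, 0 < s < delta ->
    Defs.head n (fst (loop n th) + s * fst (leftn v), snd (loop n th) + s * snd (leftn v)).
Proof.
  intros D N. pose proof PI_RGT_0 as P.
  destruct D as [D1 D2].
  pose proof (is_derive_unique _ _ _ D1) as U1.
  rewrite (is_derive_unique _ _ _ (dome_loop_x_derive th)) in U1.
  pose proof (is_derive_unique _ _ _ D2) as U2.
  pose proof (sin2_cos2 (2 * PI * th)) as SC. unfold Rsqr in SC.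
  destruct (Rtotal_order (cos (2 * PI * th)) 0) as [L|[L|L]].
  - rewrite (is_derive_unique _ _ _ (dome_loop_y_derive_lower th L)) in U2.
    exists (H / (PI * r)). split; [apply Rdiv_lt_0_compat; nra|]. intros s Hs.
    rewrite dome_loop. unfold leftn. simpl. rewrite <- U1, <- U2, Rabs_left by exact L.
    set (sn := sin (2 * PI * th)) in *. set (co := cos (2 * PI * th)) in *.
    assert (B : s * (PI * r) < H).
    { apply (Rmult_lt_reg_r (/ (PI * r))); [apply Rinv_0_lt_compat; nra|].
      replace (s * (PI * r) * / (PI * r)) with s by (field; lra). lra. }
    apply dome_head_iff.
    assert (0 <= s * (PI * r)) by (apply Rmult_le_pos; nra).
    replace (H * (co + - co) + s * (- (2 * PI * r) * co)) with (2 * (s * (PI * r)) * (- co)) by ring.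
    split; [apply Rmult_le_pos; lra|].
    replace (4 * H ^ 2 * (r ^ 2 - (c - r * sn + s * - 0 - c) ^ 2))
      with (r ^ 2 * (4 * (H * H) * (1 - sn * sn))) by ring.
    replace (1 - sn * sn) with (co * co) by lra.
    apply Rmult_le_compat_l; [nra|].
    replace ((2 * (s * (PI * r)) * - co) ^ 2)
      with (4 * ((s * (PI * r)) * (s * (PI * r))) * (co * co)) by ring.
    apply Rmult_le_compat_r; [nra|]. apply Rmult_le_compat_l; [lra|].
    apply Rmult_le_compat; lra.
  - exfalso. apply N. apply (dome_loop_corner th); [exact L|]. now split.
  - rewrite (is_derive_unique _ _ _ (dome_loop_y_derive_upper th L)) in U2.
    (* The two bounds keep [g] and [b] below in the unit interval: the step multiplies the offset
       from [c] by [1 - b] and the height by [1 - g], hence stays in the half-ellipse. *)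
    exists (Rmin (H / (PI * r)) (r / (4 * PI * H))).
    split; [apply Rmin_pos; apply Rdiv_lt_0_compat; nra|]. intros s Hs.
    pose proof (Rmin_l (H / (PI * r)) (r / (4 * PI * H))).
    pose proof (Rmin_r (H / (PI * r)) (r / (4 * PI * H))).
    rewrite dome_loop. unfold leftn. simpl. rewrite <- U1, <- U2, Rabs_pos_eq by lra.
    set (sn := sin (2 * PI * th)) in *. set (co := cos (2 * PI * th)) in *.
    assert (0 < PI * H) by (apply Rmult_lt_0_compat; lra).
    assert (0 < PI * r) by (apply Rmult_lt_0_compat; lra).
    set (g := s * (PI * r) / H). set (b := s * (4 * PI * H) / r).
    assert (G : 0 <= g <= 1).
    { unfold g. split; [apply Rmult_le_pos; [apply Rmult_le_pos; lra|apply Rlt_le, Rinv_0_lt_compat; lra]|].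
      apply (Rmult_le_reg_r (H / (PI * r))); [apply Rdiv_lt_0_compat; nra|].
      replace (s * (PI * r) / H * (H / (PI * r))) with s by (field; lra). lra. }
    assert (B : 0 <= b <= 1).
    { unfold b. split; [apply Rmult_le_pos; [apply Rmult_le_pos; lra|apply Rlt_le, Rinv_0_lt_compat; lra]|].
      apply (Rmult_le_reg_r (r / (4 * PI * H))); [apply Rdiv_lt_0_compat; nra|].
      replace (s * (4 * PI * H) / r * (r / (4 * PI * H))) with s by (field; lra). lra. }
    apply dome_head_iff.
    replace (H * (co + co) + s * (- (2 * PI * r) * co)) with (2 * H * co * (1 - g))
      by (unfold g; field; lra).
    replace (c - r * sn + s * - (- (4 * PI * H) * sn) - c) with (- r * sn * (1 - b))
      by (unfold b; field; lra).
    split; [apply Rmult_le_pos; [nra|lra]|].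
    assert (g2 : (1 - g) * (1 - g) <= 1) by nra.
    assert (b2 : (1 - b) * (1 - b) <= 1) by nra.
    assert (co * co * ((1 - g) * (1 - g)) <= co * co) by nra.
    assert (sn * sn * ((1 - b) * (1 - b)) <= sn * sn) by nra.
    replace (r ^ 2 * (2 * H * co * (1 - g)) ^ 2)
      with (4 * (r * r * (H * H)) * (co * co * ((1 - g) * (1 - g)))) by ring.
    replace (4 * H ^ 2 * (r ^ 2 - (- r * sn * (1 - b)) ^ 2))
      with (4 * (r * r * (H * H)) * (1 - sn * sn * ((1 - b) * (1 - b)))) by ring.
    apply Rmult_le_compat_l; [|lra].
    apply Rmult_le_pos; [lra|]. apply Rmult_le_pos; nra.
Qed.

Lemma dome_embedding : noose_embedding n.
Proof.
  repeat split.
  - intros q. apply continuous_pair.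
    + apply (continuous_comp snd (fun y => c - r * y)).
      * destruct q. apply continuous_snd.
      * apply (ex_derive_continuous (fun y => c - r * y)). now auto_derive.
    + assert (C : continuous (fun p : pt => H * (fst p + sqrt (1 - snd p ^ 2))) q).
      { apply (continuous_mult (fun _ : pt => H) (fun p : pt => fst p + sqrt (1 - snd p ^ 2)));
          [apply continuous_const|].
        apply (continuous_plus (fst : pt -> R) (fun p : pt => sqrt (1 - snd p ^ 2))).
        - destruct q. apply continuous_fst.
        - apply (continuous_comp snd (fun y => sqrt (1 - y ^ 2))).
          + destruct q. apply continuous_snd.
          (* Outside the disk the radicand may be negative, where [sqrt] is 0; so continuity holds
             on the whole plane. *)
          + apply (continuous_comp (fun y => 1 - y ^ 2) sqrt); [|apply continuous_sqrt].
            apply (ex_derive_continuous (fun y => 1 - y ^ 2)). now auto_derive. }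
      exact C.
  - intros t. apply continuous_pair.
    + apply (ex_derive_continuous (fun t => c * (2 - t))). now auto_derive.
    + apply (ex_derive_continuous (fun t => 2 * H + (t - 1))). now auto_derive.
  - intros [a1 a2] [b1 b2] _ _ E. injection E as E1 E2.
    assert (a2 = b2) as <- by (apply (Rmult_eq_reg_l r); lra).
    f_equal. apply Rmult_eq_reg_l in E2; lra.
  - intros t1 t2 _ _ E. injection E as _ E. lra.
  - simpl. rewrite Rmult_0_l, Rminus_0_r, sqrt_1. f_equal; ring.
  - intros t q Ht. apply dome_rope_above. lra.
  - exact dome_left_side.
Qed.

(** The loop parameter over [(x, 0)]: the solution of [x = c - r * sin (2 * PI * th)] on the branch
    with negative cosine. *)
Definition bottom_angle (x : R) : R := 1 / 2 - asin ((c - x) / r) / (2 * PI).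

Lemma bottom_ratio x : c - r < x < c + r -> -1 < (c - x) / r < 1.
Proof.
  intros Hx. split; apply (Rmult_lt_reg_l r); try lra;
    replace (r * ((c - x) / r)) with (c - x) by (field; lra); lra.
Qed.

Lemma bottom_angle_turn x : 2 * PI * bottom_angle x = PI - asin ((c - x) / r).
Proof. pose proof PI_RGT_0. unfold bottom_angle. field. lra. Qed.

Lemma bottom_angle_range x : c - r < x < c + r -> 1 / 4 < bottom_angle x < 3 / 4.
Proof.
  intros Hx. apply bottom_ratio in Hx. pose proof PI_RGT_0 as P.
  pose proof (asin_bound_lt _ Hx) as B. pose proof (bottom_angle_turn x) as E.
  split; apply (Rmult_lt_reg_l (2 * PI)); lra.
Qed.

Lemma bottom_angle_cos x : c - r < x < c + r -> cos (2 * PI * bottom_angle x) < 0.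
Proof.
  intros Hx. apply bottom_ratio in Hx. rewrite bottom_angle_turn.
  pose proof (asin_bound_lt _ Hx) as B. apply cos_lt_0; lra.
Qed.

Lemma loop_bottom_angle x : c - r < x < c + r -> loop n (bottom_angle x) = (x, 0).
Proof.
  intros Hx. pose proof (bottom_angle_cos x Hx) as C.
  rewrite dome_loop, Rabs_left by exact C. f_equal; [|ring].
  rewrite bottom_angle_turn. apply bottom_ratio in Hx.
  rewrite sin_PI_x, sin_asin by lra. field. lra.
Qed.

Lemma bottom_angle_increasing x y : c - r < x -> x < y -> y < c + r ->
  bottom_angle x < bottom_angle y.
Proof.
  intros Hx Hxy Hy. pose proof PI_RGT_0 as P.
  apply (Rmult_lt_reg_l (2 * PI)); [lra|]. rewrite !bottom_angle_turn.
  apply Rplus_lt_compat_l, Ropp_lt_contravar, Rnot_le_lt. intros L.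
  pose proof (bottom_ratio x ltac:(lra)) as Bx. pose proof (bottom_ratio y ltac:(lra)) as By.
  pose proof (asin_bound ((c - x) / r)). pose proof (asin_bound ((c - y) / r)).
  apply sin_incr_1 in L; try lra. rewrite !sin_asin in L by lra.
  apply (Rmult_le_compat_l r) in L; [|lra].
  replace (r * ((c - x) / r)) with (c - x) in L by (field; lra).
  replace (r * ((c - y) / r)) with (c - y) in L by (field; lra). lra.
Qed.

Lemma bottom_angle_unique x th : 0 <= th <= 1 -> cos (2 * PI * th) < 0 ->
  loop n th = (x, 0) -> th = bottom_angle x.
Proof.
  intros Hth C E. pose proof PI_RGT_0 as P. rewrite dome_loop in E. injection E as E _.
  set (a := 2 * PI * th) in *.
  assert (Ba : 0 <= a <= 2 * PI) by (unfold a; split; nra).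
  assert (Ha : PI / 2 <= a <= 3 * (PI / 2)).
  { split; apply Rnot_lt_le; intros L.
    - assert (0 <= cos a) by (apply cos_ge_0; lra). lra.
    - assert (0 <= cos a); [|lra].
      replace a with ((a - 2 * PI) + 2 * INR 1 * PI) by (simpl; ring).
      rewrite cos_period. apply cos_ge_0; lra. }
  assert (Es : (c - x) / r = sin (PI - a)).
  { rewrite sin_PI_x, <- E. field. lra. }
  apply (Rmult_eq_reg_l (2 * PI)); [|lra].
  rewrite bottom_angle_turn, Es, asin_sin by lra. unfold a. ring.
Qed.

Lemma dome_path_derive th : 0 < th < 1 -> cos (2 * PI * th) < 0 ->
  dvec (noose_path n) (1 + th) = (- (2 * PI * r) * cos (2 * PI * th), 0).
Proof.
  intros Hth C.
  assert (L : locally (1 + th) (fun s => loop n (s - 1) = noose_path n s)).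
  { assert (m : 0 < Rmin th (1 - th)) by (apply Rmin_pos; lra).
    exists (mkposreal _ m). intros s Hs.
    unfold ball in Hs; simpl in Hs. unfold AbsRing_ball, abs, minus, plus, opp in Hs; simpl in Hs.
    pose proof (Rmin_l th (1 - th)). pose proof (Rmin_r th (1 - th)). apply Rabs_def2 in Hs.
    unfold noose_path. destruct (Rle_dec s 1); [lra|]. destruct (Rle_dec s 2); [reflexivity|lra]. }
  assert (G : forall (f : R -> R) d, is_derive f th d -> is_derive (fun s => f (s - 1)) (1 + th) d).
  { intros f d0 Hf. evar_last.
    - apply (is_derive_comp f (fun s => s - 1)).
      + replace (1 + th - 1) with th by ring. exact Hf.
      + apply (is_derive_minus (fun y => y) (fun _ => 1));
          [apply is_derive_id|apply @is_derive_const].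
    - unfold scal, minus, plus, opp, zero, one; simpl. unfold mult; simpl. ring. }
  unfold dvec. f_equal; apply is_derive_unique.
  - apply is_derive_ext_loc with (fun s => fst (loop n (s - 1))).
    + revert L. apply filter_imp. intros s ->. reflexivity.
    + apply (G (fun s => fst (loop n s))). apply dome_loop_x_derive.
  - apply is_derive_ext_loc with (fun s => snd (loop n (s - 1))).
    + revert L. apply filter_imp. intros s ->. reflexivity.
    + apply (G (fun s => snd (loop n s))). now apply dome_loop_y_derive_lower.
Qed.

Lemma dome_rope_derive t : is_dvec (rope_map n) t (- c, 1).
Proof. split; simpl; auto_derive; trivial; ring. Qed.

End Dome.

(** * The noose system *)

(** A semicircle whose diameter lies inside an interval runs strictly below the semicircle over the
    whole interval. *)
Lemma product_lt_enclosing (l h a b x : R) : l < a < h -> l < b < h ->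
  0 < (x - a) * (b - x) -> l < x < h /\ (x - a) * (b - x) < (x - l) * (h - x).
Proof.
  assert (G : forall a b, l < a -> b < h -> a < b -> 0 < (x - a) * (b - x) ->
    l < x < h /\ (x - a) * (b - x) < (x - l) * (h - x)).
  { clear a b. intros a b Ha Hb L P. pose proof (product_pos_between a b x L P).
    split; [lra|]. apply Rmult_le_0_lt_compat; lra. }
  intros Ha Hb P. destruct (Rtotal_order a b) as [L|[<-|L]].
  - apply G; lra.
  - exfalso. pose proof (pow2_ge_0 (x - a)). nra.
  - replace ((x - a) * (b - x)) with ((x - b) * (a - x)) in * by ring. apply G; lra.
Qed.

Lemma Forall2_map_seq {A B : Type} (P : A -> B -> Prop) (f : nat -> A) (l : list B) (d : B) a :
  (forall i, (i < length l)%nat -> P (f (a + i)%nat) (nth i l d)) ->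
  Forall2 P (map f (seq a (length l))) l.
Proof.
  revert a; induction l as [|b l IH]; intros a H; simpl; constructor.
  - specialize (H O). rewrite Nat.add_0_r in H. apply H. simpl. lia.
  - apply IH. intros i Hi. specialize (H (Datatypes.S i)).
    replace (Datatypes.S a + i)%nat with (a + Datatypes.S i)%nat by lia. apply H. simpl. lia.
Qed.

Lemma StronglySorted_map {A : Type} (Q : A -> A -> Prop) (f : nat -> A) (l : list nat) :
  (forall x y, In x l -> In y l -> (x < y)%nat -> Q (f x) (f y)) ->
  StronglySorted lt l -> StronglySorted Q (map f l).
Proof.
  intros H Hs. induction Hs as [|x l Hl IH F]; simpl; constructor.
  - apply IH. intros a b Ha Hb. apply H; now right.
  - apply Forall_forall. intros q Hq. apply in_map_iff in Hq as (y & <- & Hy).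
    rewrite Forall_forall in F. apply H; simpl; auto.
Qed.

Section NooseSystem.

Context {S : Type} (d : S * bool) (ws : list (word S)) (inn out : nat -> nat)
  (cyc : list (nat * nat)).

Let lett := site_letter d ws.
Let K := sites ws.
Let N := stride ws.

Hypothesis scheme : arc_scheme lett K (fun k => (k / N)%nat) inn out.
Hypothesis cycles : cycle_decomposition (next lett inn out) K cyc.

Let D := diagram lett inn out cyc.

(** The margins 1/2 and 1/4 add up to less than 1, the least spacing of abscissae, so the intervals
    of different blocks are strictly separated. *)
Definition left_end (i : nat) : R := abscissa (i * N) - 1 / 2.
Definition right_end (i : nat) : R := abscissa (i * N + length (nth i ws [])) + 1 / 4.
Definition centre (i : nat) : R := (left_end i + right_end i) / 2.
Definition radius (i : nat) : R := (right_end i - left_end i) / 2.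
(** The abscissa just past all blocks exceeds every radius. A half-ellipse of height twice that
    contains the semicircle over its own base. *)
Definition height : R := abscissa (length ws * N).

Definition word_noose_at (i : nat) : noose := dome_noose (centre i) (radius i) height.
Definition nooses : list noose := map word_noose_at (seq 0 (length ws)).

Arguments left_end i%_nat_scope.
Arguments right_end i%_nat_scope.

Lemma abscissa_le (k l : nat) : (k <= l)%nat -> abscissa k <= abscissa l.
Proof. intros H. apply IZR_le. now apply zpos_le. Qed.

Lemma ends_ordered i j : (i < j)%nat -> right_end i < left_end j.
Proof.
  intros H. unfold left_end, right_end. pose proof (length_lt_stride ws i) as L. fold N in L.
  assert (abscissa (i * N + length (nth i ws [])) + 1 <= abscissa (j * N)); [|lra].
  apply abscissa_lt. nia.
Qed.

Lemma radius_pos i : 0 < radius i.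
Proof.
  unfold radius, left_end, right_end.
  pose proof (abscissa_le (i * N) (i * N + length (nth i ws [])) ltac:(lia)). lra.
Qed.

Lemma height_pos : 2 <= height.
Proof. apply abscissa_ge_2. Qed.

Lemma radius_le_height i : (i < length ws)%nat -> radius i <= height.
Proof.
  intros H. apply ends_ordered in H. pose proof (abscissa_ge_2 (i * N)) as B.
  pose proof height_pos.
  (* The block one past the last has no word, but its left end bounds all others. *)
  change (left_end (length ws)) with (height - 1 / 2) in H.
  unfold radius, left_end. lra.
Qed.

Lemma ends_eq i : centre i - radius i = left_end i /\ centre i + radius i = right_end i.
Proof. unfold centre, radius. lra. Qed.

Lemma site_between k : In k K ->
  (k / N < length ws)%nat /\ left_end (k / N) < abscissa k < right_end (k / N).
Proof.
  intros H. apply in_sites in H as [H1 H2]. split; [exact H1|].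
  pose proof (Nat.div_mod_eq k (stride ws)) as E. fold N in E, H1, H2.
  rewrite Nat.mul_comm in E.
  set (q := (k / N)%nat) in *. set (r := (k mod N)%nat) in *.
  unfold left_end, right_end. split.
  - pose proof (abscissa_le (q * N) k ltac:(lia)). lra.
  - pose proof (abscissa_le k (q * N + length (nth q ws [])) ltac:(lia)). lra.
Qed.

Lemma on_diagram_arc q : on_diagram D q ->
  exists k u, In k K /\ 0 <= u < 1 /\ arc lett inn out k u = q.
Proof.
  intros (i & t & P). apply (preimage_strand lett K inn out cyc cycles) in P as (k & u & Hs & E).
  exists k, u. destruct (strand_site lett K _ inn out scheme cyc cycles _ _ _ _ Hs). auto.
Qed.

(** Above the axis the arc comes from [inn], so both its ends lie in one block and it runs below the
    semicircle over that block. *)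
Lemma diagram_above q : on_diagram D q -> 0 < snd q ->
  exists i, (i < length ws)%nat /\ left_end i < fst q < right_end i /\
    snd q * snd q < (fst q - left_end i) * (right_end i - fst q).
Proof.
  intros Hq Hy. apply on_diagram_arc in Hq as (k & u & Hk & Hu & <-).
  assert (u0 : 0 < u).
  { destruct (Rle_lt_or_eq_dec 0 u) as [L|<-]; [lra|exact L|].
    rewrite arc_0 in Hy. simpl in Hy. lra. }
  pose proof (arc_side _ _ _ _ _ scheme k u Hk ltac:(lra)) as Hs.
  assert (Sk : snd (lett k) = false).
  { unfold side in Hs. destruct (snd (lett k)); [nra|reflexivity]. }
  assert (En : next lett inn out k = inn k) by (unfold next; now rewrite Sk).
  pose proof (arc_eq lett inn out k u) as E. rewrite En in E.
  destruct (inn_matching _ _ _ _ _ scheme k Hk) as (Ik & _).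
  destruct (site_between k Hk) as [L1 L2]. destruct (site_between _ Ik) as [_ L3].
  rewrite (inn_block _ _ _ _ _ scheme k Hk) in L3.
  exists (k / N)%nat. split; [exact L1|]. rewrite <- E.
  apply product_lt_enclosing; auto. rewrite E. nra.
Qed.

Lemma diagram_axis q : on_diagram D q -> snd q = 0 -> exists k, In k K /\ q = (abscissa k, 0).
Proof.
  intros Hq Hy. apply on_diagram_arc in Hq as (k & u & Hk & Hu & <-).
  exists k. split; [exact Hk|].
  destruct (Rle_lt_or_eq_dec 0 u) as [L|<-]; [lra| |apply arc_0].
  pose proof (arc_side _ _ _ _ _ scheme k u Hk ltac:(lra)) as Hs. rewrite Hy in Hs. lra.
Qed.

Lemma diagram_low q : on_diagram D q -> snd q < 2 * height.
Proof.
  intros Hq. pose proof height_pos as Hp. apply Rnot_le_lt. intros L.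
  destruct (diagram_above q Hq ltac:(lra)) as (i & Hi & Hx & Hy).
  pose proof (radius_le_height i Hi) as R1. pose proof (radius_pos i) as R0.
  destruct (ends_eq i) as [E1 E2]. rewrite <- E1, <- E2 in Hy.
  assert ((fst q - (centre i - radius i)) * (centre i + radius i - fst q) <= radius i * radius i).
  { pose proof (pow2_ge_0 (fst q - centre i)). nra. }
  assert (radius i * radius i <= height * height) by nra. nra.
Qed.

Lemma crossing_above q : crossing D q -> on_diagram D q /\ 0 < snd q.
Proof.
  intros (i & t & j & s & P1 & P2 & Ne). split; [exists i, t; exact P1|].
  destruct (diagram_crossing _ _ _ _ _ scheme cyc cycles _ _ _ _ _ P1 P2 Ne)
    as (k & l & u & v & Su & _ & <- & _ & _ & Sk & _ & Hu & _).
  destruct (strand_site lett K _ inn out scheme cyc cycles _ _ _ _ Su) as [Hk _].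
  pose proof (arc_side _ _ _ _ _ scheme k u Hk ltac:(lra)) as Hs.
  unfold side in Hs. rewrite Sk in Hs. lra.
Qed.

Lemma head_iff i q : Defs.head (word_noose_at i) q <->
  0 <= snd q /\
  radius i ^ 2 * snd q ^ 2 <= 4 * height ^ 2 * ((fst q - left_end i) * (right_end i - fst q)).
Proof.
  pose proof height_pos. destruct q as [x y]. simpl fst. simpl snd.
  unfold word_noose_at. rewrite dome_head_iff; [|apply radius_pos|lra].
  replace (radius i ^ 2 - (x - centre i) ^ 2) with ((x - left_end i) * (right_end i - x));
    [reflexivity|]. unfold radius, centre. field.
Qed.

(** The last clause, that the top level is reached only at the apex, separates a head from the
    starting points of other ropes. *)
Lemma head_bounds i q : Defs.head (word_noose_at i) q ->
  left_end i <= fst q <= right_end i /\ snd q <= 2 * height /\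
  (snd q = 2 * height -> fst q = centre i).
Proof.
  intros Hq. pose proof height_pos as Hp. pose proof (radius_pos i) as Rp.
  apply head_iff in Hq as [Y Q].
  set (w := fst q - centre i).
  replace ((fst q - left_end i) * (right_end i - fst q)) with (radius i ^ 2 - w ^ 2) in Q
    by (unfold w, radius, centre; field).
  assert (r2 : 0 < radius i ^ 2) by nra. assert (h2 : 0 < 4 * height ^ 2) by nra.
  pose proof (pow2_ge_0 w) as w2. pose proof (pow2_ge_0 (snd q)) as y2.
  assert (P : w ^ 2 <= radius i ^ 2).
  { apply Rnot_lt_le. intros L.
    assert (0 < 4 * height ^ 2 * (w ^ 2 - radius i ^ 2)) by (apply Rmult_lt_0_compat; lra).
    assert (0 <= radius i ^ 2 * snd q ^ 2) by (apply Rmult_le_pos; lra). lra. }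
  assert (0 <= 4 * height ^ 2 * w ^ 2) by (apply Rmult_le_pos; lra).
  split; [|split].
  - destruct (ends_eq i) as [<- <-].
    assert (Rabs w <= Rabs (radius i)) as A.
    { apply Rsqr_le_abs_0. unfold Rsqr. lra. }
    rewrite (Rabs_pos_eq (radius i)) in A by lra. apply Rabs_le_between in A.
    unfold w in A. lra.
  - apply Rsqr_incr_0_var; [|lra]. unfold Rsqr. apply (Rmult_le_reg_l (radius i ^ 2)); [exact r2|].
    lra.
  - intros E. rewrite E in Q.
    assert (Z : 4 * height ^ 2 * w ^ 2 <= 0) by lra.
    assert (w ^ 2 = 0) by (apply Rle_antisym; [apply (Rmult_le_reg_l (4 * height ^ 2)); lra|lra]).
    assert (w = 0) by nra. unfold w in *. lra.
Qed.

(** The strict inequality goes beyond membership in the head: it keeps the diagram off the elliptic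
    part of the loop. *)
Lemma above_in_head q : on_diagram D q -> 0 < snd q -> exists i, (i < length ws)%nat /\
  left_end i < fst q < right_end i /\ Defs.head (word_noose_at i) q /\
  radius i ^ 2 * snd q ^ 2 < 4 * height ^ 2 * ((fst q - left_end i) * (right_end i - fst q)).
Proof.
  intros Hq Hy. pose proof height_pos.
  destruct (diagram_above q Hq Hy) as (i & Hi & Hx & L). exists i.
  pose proof (radius_pos i). pose proof (radius_le_height i Hi).
  assert (G : radius i ^ 2 * snd q ^ 2 <
    4 * height ^ 2 * ((fst q - left_end i) * (right_end i - fst q))).
  { assert (0 < snd q * snd q) by nra.
    apply Rle_lt_trans with (4 * height ^ 2 * (snd q * snd q)).
    - replace (snd q ^ 2) with (snd q * snd q) by ring. apply Rmult_le_compat_r; nra.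
    - apply Rmult_lt_compat_l; nra. }
  repeat split; try lra; auto. apply head_iff. lra.
Qed.

Lemma loop_head i th : Defs.head (word_noose_at i) (loop (word_noose_at i) th).
Proof.
  eexists. split; [|reflexivity]. unfold in_disk. simpl.
  pose proof (sin2_cos2 (2 * PI * th)) as E. unfold Rsqr in E. lra.
Qed.

Lemma heads_apart i j q : Defs.head (word_noose_at i) q -> left_end j < fst q < right_end j -> i = j.
Proof.
  intros Hi Hj. apply head_bounds in Hi as [Hi _].
  destruct (Nat.lt_trichotomy i j) as [L|[L|L]]; [|exact L|]; apply ends_ordered in L; lra.
Qed.

(** On the elliptic arc the inequality of [above_in_head] would be an equality. The corners are the
    ends of the block interval, and sites lie strictly between them. *)
Lemma loop_meets_diagram i th : on_diagram D (loop (word_noose_at i) th) ->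
  cos (2 * PI * th) < 0 /\
  exists k, In k K /\ (k / N)%nat = i /\ loop (word_noose_at i) th = (abscissa k, 0).
Proof.
  intros Hq. pose proof height_pos as Hp. pose proof (radius_pos i) as Rp.
  pose proof (loop_head i th) as Hh.
  assert (Ef : fst (loop (word_noose_at i) th) = centre i - radius i * sin (2 * PI * th)).
  { unfold word_noose_at. now rewrite dome_loop. }
  assert (Es : snd (loop (word_noose_at i) th) =
    height * (cos (2 * PI * th) + Rabs (cos (2 * PI * th)))).
  { unfold word_noose_at. now rewrite dome_loop. }
  set (q := loop (word_noose_at i) th) in *.
  pose proof (sin2_cos2 (2 * PI * th)) as SC. unfold Rsqr in SC.
  set (sn := sin (2 * PI * th)) in *. set (co := cos (2 * PI * th)) in *.
  destruct (Rlt_le_dec 0 co) as [L|L].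
  { exfalso. rewrite Rabs_pos_eq in Es by lra.
    destruct (above_in_head q Hq) as (j & _ & Hx & _ & B); [rewrite Es; nra|].
    apply (heads_apart i j) in Hx; [|exact Hh]. subst j. rewrite Es, Ef in B.
    destruct (ends_eq i) as [E1 E2]. rewrite <- E1, <- E2 in B.
    replace ((centre i - radius i * sn - (centre i - radius i)) *
      (centre i + radius i - (centre i - radius i * sn)))
      with (radius i ^ 2 * (1 - sn * sn)) in B by ring.
    replace (1 - sn * sn) with (co * co) in B by lra. lra. }
  rewrite Rabs_left1 in Es by exact L.
  destruct (diagram_axis q Hq) as (k & Hk & E); [rewrite Es; ring|].
  destruct (site_between k Hk) as [_ B].
  assert (Ek : (k / N)%nat = i).
  { symmetry. apply (heads_apart i _ q Hh). rewrite E. exact B. }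
  split; [|exists k; auto].
  apply Rnot_le_lt. intros L'. assert (c0 : co = 0) by lra.
  rewrite c0, Rmult_0_r, Rplus_0_r in SC. rewrite Ek in B.
  rewrite E in Ef. simpl in Ef. destruct (ends_eq i) as [E1 E2]. rewrite <- E1, <- E2, Ef in B.
  assert (sn < 1) by (apply (Rmult_lt_reg_l (radius i)); lra).
  assert (-1 < sn) by (apply (Rmult_lt_reg_l (radius i)); lra). nra.
Qed.

Lemma rope_above i t : 1 <= t -> ~ on_diagram D (rope_map (word_noose_at i) t).
Proof. intros Ht Hq. apply diagram_low in Hq. simpl in Hq. lra. Qed.

Lemma axis_strand i t k : preimage D (abscissa k, 0) i t -> In k K -> exists m, 0 < m /\
  tangent D i t = (0, m * side lett k).
Proof.
  intros P Hk. apply (preimage_strand lett K inn out cyc cycles) in P as (l & u & Hs & E).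
  destruct (strand_site lett K _ inn out scheme cyc cycles _ _ _ _ Hs) as [Hl Hu].
  rewrite <- (arc_0 lett inn out k) in E.
  destruct (arc_meet lett K _ inn out scheme l k u 0) as [[-> ->]|M]; auto; try lra.
  destruct (strand_tangent lett K _ inn out scheme cyc cycles _ _ _ _ Hs) as (m & m0 & T).
  exists m. split; [exact m0|]. unfold D. rewrite T.
  rewrite (darc_0 lett K _ inn out scheme) by exact Hk. simpl. f_equal. ring.
Qed.

Lemma noose_for_diagram i : noose_for D (word_noose_at i).
Proof.
  pose proof height_pos as Hp. pose proof (radius_pos i) as Rp. pose proof PI_RGT_0 as Pp.
  assert (H0 : 0 < height) by lra.
  split; [apply dome_embedding; lra|]. split; [apply rope_above; lra|].
  split; [apply rope_above; lra|]. split; [|split].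
  - intros th Hq. destruct (loop_meets_diagram i th Hq) as (C & k & Hk & Ek & E).
    split.
    + intros Hc. apply crossing_above in Hc as [_ Hc]. rewrite E in Hc. simpl in Hc. lra.
    + exists (- (2 * PI * radius i) * cos (2 * PI * th), 0). split.
      * split; [apply dome_loop_x_derive; lra|apply dome_loop_y_derive_lower; lra].
      * intros j t P. rewrite E in P. destruct (axis_strand j t k P Hk) as (m & m0 & ->).
        pose proof (side_sqr lett k). assert (side lett k <> 0) by (intros F; rewrite F in *; lra).
        unfold det. simpl. rewrite Rmult_0_l, Rminus_0_l.
        assert (0 < 2 * PI * radius i) by (apply Rmult_lt_0_compat; lra).
        apply Ropp_neq_0_compat.
        repeat apply Rmult_integral_contrapositive_currified; lra.
  - intros t Ht Hq. exfalso. now apply (rope_above i t).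
  - destruct (dome_rope_derive (centre i) (radius i) height 2) as [D1 D2].
    split; [eexists; exact D1|]. split; [eexists; exact D2|].
    intros E. apply (f_equal snd) in E.
    pose proof (eq_trans (eq_sym E) (is_derive_unique _ _ _ D2)) as F. simpl in F. lra.
Qed.

Lemma noose_word_at i : (i < length ws)%nat -> noose_word D (word_noose_at i) (nth i ws []).
Proof.
  intros Hi. pose proof height_pos as Hp. pose proof (radius_pos i) as Rp.
  pose proof PI_RGT_0 as Pp. assert (H0 : 0 < height) by lra.
  set (B := seq (i * N) (length (nth i ws []))).
  assert (HB : forall k, In k B <-> In k K /\ (k / N)%nat = i).
  { intros k. unfold B, K, N. rewrite in_block, in_sites.
    split; [intros [<- H]; auto|intros [[H1 H2] <-]; auto]. }
  (* The dummy witness off [K] makes the choice function [g] total; it gives component and time of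
     each site. *)
  assert (G : forall k, exists it, In k K -> strand lett inn out cyc (fst it) (snd it) k 0).
  { intros k. destruct (classic (In k K)) as [H|H].
    - destruct (strand_exists lett K inn out cyc cycles k 0 H ltac:(lra)) as (a & t & Hs).
      now exists (a, t).
    - exists (O, 0). tauto. }
  set (g := fun k => proj1_sig (constructive_indefinite_description _ (G k))).
  assert (Hg : forall k, In k K -> strand lett inn out cyc (fst (g k)) (snd (g k)) k 0).
  { intros k. unfold g. apply proj2_sig. }
  set (th := fun k => bottom_angle (centre i) (radius i) (abscissa k)).
  assert (Bd : forall k, In k B -> centre i - radius i < abscissa k < centre i + radius i).
  { intros k Hk. apply HB in Hk as [Hk <-]. destruct (ends_eq (k / N)) as [-> ->].
    now apply site_between. }
  assert (path_th : forall k, In k B -> noose_path (word_noose_at i) (1 + th k) = (abscissa k, 0)).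
  { intros k Hk. apply Bd in Hk. pose proof (bottom_angle_range _ _ Rp _ Hk) as Hr. fold (th k) in Hr.
    unfold noose_path. destruct (Rle_dec (1 + th k) 1); [lra|].
    destruct (Rle_dec (1 + th k) 2); [|lra].
    replace (1 + th k - 1) with (th k) by ring. apply loop_bottom_angle; auto. }
  exists (map (fun k => (1 + th k, fst (g k), snd (g k))) B). split; [|split; [|split]].
  - apply StronglySorted_Sorted, StronglySorted_map; [|apply StronglySorted_seq].
    intros x y Hx Hy L. simpl. apply Rplus_lt_compat_l.
    apply Bd in Hx, Hy. apply abscissa_lt in L. apply bottom_angle_increasing; lra.
  - apply Forall_forall. intros q Hq. apply in_map_iff in Hq as (k & <- & Hk).
    split.
    + apply Bd in Hk. pose proof (bottom_angle_range _ _ Rp _ Hk) as Hr. fold (th k) in Hr. lra.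
    + rewrite path_th by exact Hk. apply HB in Hk as [Hk _].
      rewrite <- (arc_0 lett inn out k). apply (strand_preimage lett K inn out cyc cycles); auto.
  - intros tau Ht Hq. unfold noose_path in Hq.
    destruct (Rle_dec tau 1) as [L1|L1].
    { exfalso. apply (rope_above i (2 - tau)); [lra|exact Hq]. }
    destruct (Rle_dec tau 2) as [L2|L2].
    2: { exfalso. apply (rope_above i (tau - 1)); [lra|exact Hq]. }
    destruct (loop_meets_diagram i (tau - 1) Hq) as (C & k & Hk & Ek & E).
    exists (fst (g k)), (snd (g k)). apply in_map_iff. exists k.
    split; [|apply HB; auto]. do 2 f_equal. unfold th.
    rewrite <- (bottom_angle_unique (centre i) (radius i) height Rp (abscissa k) (tau - 1));
      auto; lra.
  - assert (Ew : nth i ws [] = map lett B) by (symmetry; apply map_block).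
    rewrite Ew at 1. rewrite !map_map. apply map_ext_in. intros k Hk.
    pose proof Hk as Hk'. apply HB in Hk' as [HK _].
    pose proof (Hg k HK) as Hs.
    destruct (strand_label lett K _ inn out scheme cyc cycles _ _ _ _ Hs) as (c & Ec & Lc).
    destruct (strand_tangent lett K _ inn out scheme cyc cycles _ _ _ _ Hs) as (m & m0 & T).
    rewrite (darc_0 lett K _ inn out scheme) in T by exact HK. simpl in T.
    unfold letter_at, D. rewrite Ec, Lc, T. clear T.
    apply Bd in Hk. pose proof (bottom_angle_range _ _ Rp _ Hk) as Hr. fold (th k) in Hr.
    pose proof (bottom_angle_cos _ _ Rp _ Hk) as C. fold (th k) in C.
    unfold word_noose_at. rewrite dome_path_derive by (auto; lra).
    unfold det. simpl. set (v := - (2 * PI * radius i) * cos (2 * PI * th k)).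
    assert (v0 : 0 < v).
    { unfold v. assert (0 < 2 * PI * radius i * - cos (2 * PI * th k)); [|lra].
      apply Rmult_lt_0_compat; [apply Rmult_lt_0_compat|]; lra. }
    assert (mv : 0 < m * v) by now apply Rmult_lt_0_compat.
    (* The path moves right with speed [v] and the curve has velocity [(0, m * side lett k)], so the
       determinant is [- m * side lett k * v]: positive exactly for downward strands, which carry
       positive letters. *)
    unfold side. destruct (lett k) as [a []]; simpl; destruct Rlt_dec; try reflexivity; exfalso; lra.
Qed.

Lemma centre_increasing i j : (i < j)%nat -> centre i < centre j.
Proof.
  intros L. apply ends_ordered in L. pose proof (radius_pos i). pose proof (radius_pos j).
  destruct (ends_eq i). destruct (ends_eq j). lra.
Qed.

(** Heads lie over disjoint intervals; a head and a foreign rope could meet only at the apex level,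
    where the centres differ; on two ropes equal height means equal [t], which leaves only the
    root. *)
Lemma nooses_meet_at_base i j q : i <> j ->
  in_noose (word_noose_at i) q -> in_noose (word_noose_at j) q -> q = (0, 2 * height + 1).
Proof.
  assert (C : forall a b, a <> b -> centre a <> centre b).
  { intros a b Hab E. destruct (Nat.lt_gt_cases a b) as [G _].
    destruct (G Hab) as [L|L]; apply centre_increasing in L; lra. }
  assert (HR : forall a b, a <> b -> Defs.head (word_noose_at a) q ->
    on_rope (word_noose_at b) q -> False).
  { intros a b Hab Ha (t & Ht & <-). apply head_bounds in Ha as (_ & H1 & H2). simpl in H1, H2.
    assert (t = 1) as -> by lra. apply (C b a); [auto|]. rewrite <- H2 by ring. ring. }
  intros Hij [Hi|Hi] [Hj|Hj].
  - exfalso. destruct (head_bounds _ _ Hi) as [Bi _]. destruct (head_bounds _ _ Hj) as [Bj _].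
    destruct (Nat.lt_gt_cases i j) as [G _].
    destruct (G Hij) as [L|L]; apply ends_ordered in L; lra.
  - exfalso. apply (HR i j); auto.
  - exfalso. apply (HR j i); auto.
  - destruct Hi as (t & Ht & <-). destruct Hj as (s & Hs & E). simpl in *.
    injection E as E1 E2. assert (s = t) as -> by lra.
    assert (t = 2) as ->; [|f_equal; ring].
    apply Rminus_diag_uniq_sym.
    apply (Rmult_eq_reg_l (centre j - centre i)); [lra|].
    pose proof (C i j Hij). lra.
Qed.

Lemma nooses_system : noose_system D nooses.
Proof.
  pose proof height_pos as Hp. pose proof PI_RGT_0 as Pp.
  assert (nth_nooses : forall i n, nth_error nooses i = Some n ->
    (i < length ws)%nat /\ n = word_noose_at i).
  { intros i n E. unfold nooses in E. rewrite nth_error_map in E.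
    destruct (nth_error (seq 0 (length ws)) i) as [k|] eqn:Ek; [|discriminate].
    injection E as <-.
    assert (L : (i < length ws)%nat).
    { rewrite <- (length_seq (length ws) 0). apply nth_error_Some. congruence. }
    split; [exact L|]. apply (nth_error_nth _ _ O) in Ek. rewrite seq_nth in Ek by exact L.
    now subst k. }
  split; [|exists (0, 2 * height + 1); split; [|split; [|split]]].
  - apply Forall_forall. intros n Hn. apply in_map_iff in Hn as (i & <- & _).
    apply noose_for_diagram.
  - apply Forall_forall. intros n Hn. apply in_map_iff in Hn as (i & <- & _).
    unfold root. simpl. f_equal; ring.
  - intros i j ni nj Hij Ei Ej q. apply nth_nooses in Ei as [_ ->]. apply nth_nooses in Ej as [_ ->].
    now apply nooses_meet_at_base.
  (* At the root the rope leaves in direction [(centre k, -1)], whose angle is this one. All ropes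
     go downwards, so the angles fit between [- PI] and 0 and increase with the centres. *)
  - exists (- PI), (fun k => - (PI / 2) + atan (centre k)). split.
    + intros k n E. apply nth_nooses in E as [_ ->].
      pose proof (atan_bound (centre k)). split; [lra|].
      assert (s0 : 0 < sqrt (1 + (centre k)²)).
      { apply sqrt_lt_R0. pose proof (Rle_0_sqr (centre k)). lra. }
      exists (sqrt (1 + (centre k)²)). split; [exact s0|].
      destruct (dome_rope_derive (centre k) (radius k) height 2) as [D1 D2].
      replace (- (PI / 2) + atan (centre k)) with (- (PI / 2 - atan (centre k))) by ring.
      rewrite cos_neg, sin_neg, cos_shift, sin_shift, sin_atan, cos_atan.
      unfold rope_dir. f_equal.
      * transitivity (- - centre k); [f_equal; exact (is_derive_unique _ _ _ D1)|field; lra].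
      * transitivity (Ropp 1); [f_equal; exact (is_derive_unique _ _ _ D2)|field; lra].
    + intros k _. apply Rplus_lt_compat_l, atan_increasing, centre_increasing. lia.
  - intros q Hq. apply crossing_above in Hq as [Hq Hy].
    destruct (above_in_head q Hq Hy) as (i & Hi & _ & Hh & _).
    exists (word_noose_at i). split; [|exact Hh]. apply in_map, in_seq. lia.
Qed.

End NooseSystem.

Theorem theorem3p3 :
  forall (S : Type), inhabited S ->
  forall ws : list (word S), commutator_identity ws ->
  exists (D : list (component S)) (ns : list noose),
    doodle D /\ noose_system D ns /\ List.Forall2 (noose_word D) ns ws.
Proof.
  intros S [a] ws Hws.
  (* Non-emptiness of [S] supplies the default letter of [site_letter]. *)
  destruct (arc_scheme_exists (a, true) ws Hws) as (inn & out & scheme).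
  destruct (cycle_decomposition_exists (next (site_letter (a, true) ws) inn out) (sites ws))
    as (cyc & cycles).
  - intros k. apply (next_site _ _ _ _ _ scheme).
  - intros k l. apply (next_inj _ _ _ _ _ scheme).
  - exists (diagram (site_letter (a, true) ws) inn out cyc), (nooses ws). split; [|split].
    + exact (diagram_doodle _ _ _ _ _ scheme cyc cycles).
    + exact (nooses_system _ _ _ _ _ scheme cycles).
    + apply (Forall2_map_seq _ _ _ []). intros i Hi. simpl.
      exact (noose_word_at _ _ _ _ _ scheme cycles i Hi).
Qed.
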